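(* Let $d_0$ be the smallest integer such that all monomials appearing in the cost, dynamics and constraint polynomials have degree at most $2d_0$, and for $d\ge d_0$ let $$p_d^*=\inf_{z}\ \sum_{\beta\in\mathbb{N}^{1+n+1+m}_{2d}}c_\beta z_\beta\quad\text{s.t.}\quad\sum_{\beta\in\mathbb{N}^{1+n+1+m}_{2d}}a_{\alpha,\beta}z_\beta=b_\alpha\ \ \forall\alpha\in\bar{\mathbb{N}}^{1+n}_{2d},\quad M_d(g_i\,z)\succeq0,\ i=0,\dots,n_G.$$ Then $p^*_{d_0}\le p^*_{d_0+1}\le\cdots\le p^*_\infty=p_F^*$.
   Context: $T=[t_0,t_f]$, $0\le t_0<t_f$; $p$ even; $y_0,y_f$ prescribed boundary states; $l\in\mathbb{R}[t,\bar y,\bar u]$, $f\in\mathbb{R}[t,\bar y,\bar u]^n$ of degree $\le p$ in $\bar u\in\mathbb{R}^m$; $Y=\{\bar y: g_i(\bar y)\ge0\}$ compact basic semialgebraic including a ball constraint. $W=\{(\bar w_0,\bar w)\in[0,1]\times\mathbb{R}^m:\bar w_0\ge0,\ \bar w_0^p=1-\sum_i\bar w_i^p\}$, $G=T\times Y\times W=\{g_i\ge0,\ i=0,\dots,n_G\}$ with $g_0=1$, equalities as two inequalities, one $g_i=r-\|(t,\bar y,\bar w_0,\bar w)\|_2^2$. Homogenization: for $h=\sum_{|\alpha|\le p}h_\alpha(t,\bar y)\bar u^\alpha$, $\hat h=\sum_\alpha h_\alpha\bar w_0^{p-|\alpha|}\bar w^\alpha$. $p_F^*=\inf_{\gamma\in\mathcal{M}^+(G)}\int\hat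 l\,d\gamma$ s.t. $\int(\frac{\partial v}{\partial t}\bar w_0^p+\frac{\partial v}{\partial\bar y}\hat f)d\gamma=v(t_f,y_f)-v(t_0,y_0)$ for all $v\in C^1(T\times Y)$. Moments $z_\beta$ indexed by monomials $e_\beta$ in $(t,\bar y,\bar w_0,\bar w)$, $\ell_z(\sum h_\beta e_\beta)=\sum h_\beta z_\beta$, localizing matrix $[M_d(g\,z)]_{\alpha,\beta}=\ell_z(g\,e_{\alpha+\beta})$ for $\alpha,\beta$ of total degree $\le d$; $c_\beta$ coefficients of $\hat l$; for $v_\alpha=t^{\alpha_1}\bar y^{(\alpha_2,\dots,\alpha_{n+1})}$, $\sum_\beta a_{\alpha,\beta}z_\beta=\ell_z(\frac{\partial v_\alpha}{\partial t}\bar w_0^p+\frac{\partial v_\alpha}{\partial\bar y}\hat f)$ and $b_\alpha=v_\alpha(t_f,y_f)-v_\alpha(t_0,y_0)$. $\mathbb{N}^k_{2d}$ is the set of multi-indices of total degree $\le 2d$; $\bar{\mathbb{N}}^{1+n}_{2d}=\{\alpha\in\mathbb{N}^{1+n}:\deg(\frac{\partial v_\alpha}{\partial t}\bar w_0^p+\frac{\partial v_\alpha}{\partial\bar y}\hat f)\le 2d\}$. $p_\infty^*$ is the value of the same problem with all moments, all $\alpha\in\mathbb{N}^{1+n}$, and $M_d(g_i\,z)\succeq0$ for all $d\in\mathbb{N}$.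
   Formalization: In the level-d problem the constraint M_d(g_i z) ⪰ 0, which would involve moments of degree above 2d, is replaced by M_{d-⌈deg g_i/2⌉}(g_i z) ⪰ 0; C^1(T×Y) is read as C^1 functions on all of R^{1+n}. *)

(* Defs.v *)
From HB Require Import structures.
From mathcomp Require Import all_boot all_order all_algebra.
From mathcomp Require Import mpoly.
From mathcomp Require Import all_classical all_reals all_analysis.

Set Implicit Arguments.
Unset Strict Implicit.
Unset Printing Implicit Defensive.

Import Order.TTheory GRing.Theory Num.Theory.
Import numFieldNormedType.Exports.
Local Open Scope ring_scope.
Local Open Scope classical_set_scope.

(* Variable layout.
   Original problem variables (t, y, u) : n.+1 + m coordinates,
     index lshift m ord0 = t, lshift m (lift ord0 j) = y_j, rshift n.+1 c = u_c.
   Moment-problem variables (t, y, w0, w) : n.+1 + m.+1 coordinates,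
     index lshift _ ord0 = t, lshift _ (lift ord0 j) = y_j,
     rshift n.+1 ord0 = w0, rshift n.+1 (lift ord0 c) = w_c. *)

Section Defs.
Variables (R : realType) (n m : nat).

Local Notation K := (n.+1 + m.+1)%N.

Definition it : 'I_K := lshift m.+1 ord0.
Definition iy (j : 'I_n) : 'I_K := lshift m.+1 (lift ord0 j).
Definition iw0 : 'I_K := rshift n.+1 ord0.
Definition iw (c : 'I_m) : 'I_K := rshift n.+1 (lift ord0 c).

Definition udeg (mon : 'X_{1..n.+1 + m}) : nat :=
  (\sum_(c < m) mon (rshift n.+1 c))%N.

Definition hom_mon (p : nat) (mon : 'X_{1..n.+1 + m}) : 'X_{1..K} :=
  [multinom match fintype.split i with
            | inl a => mon (lshift m a)
            | inr b => match unlift ord0 b with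
                       | None => (p - udeg mon)%N
                       | Some c => mon (rshift n.+1 c)
                       end
            end | i < K].

Definition hompoly (p : nat) (h : {mpoly R[n.+1 + m]}) : {mpoly R[K]} :=
  \sum_(mon <- msupp h) h@_mon *: 'X_[hom_mon p mon].

Definition evalK (q : {mpoly R[K]}) (x : 'rV[R]_K) : R := q.@[fun i => x ord0 i].

Definition Tset (t0 tf : R) : set R := [set t | t0 <= t <= tf].

Definition semialg (N nY : nat) (gY : 'I_nY -> {mpoly R[N]}) : set 'rV[R]_N :=
  [set y : 'rV[R]_N | forall j, 0 <= (gY j).@[fun i => y ord0 i]].

Definition Wset (p : nat) : set 'rV[R]_m.+1 :=
  [set w : 'rV[R]_m.+1 | 0 <= w ord0 ord0 <= 1 /\
           w ord0 ord0 ^+ p = 1 - \sum_(c < m) w ord0 (lift ord0 c) ^+ p].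

Definition Gset (t0 tf : R) (Y : set 'rV[R]_n) (p : nat) : set 'rV[R]_K :=
  [set x : 'rV[R]_K | Tset t0 tf (x ord0 it) /\
           Y (\row_(j < n) x ord0 (iy j)) /\
           Wset p (rsubmx x)].

Definition pt (t : R) (y : 'rV[R]_n) : 'rV[R]_n.+1 := row_mx (const_mx t : 'rV[R]_1) y.

Definition typart (x : 'rV[R]_K) : 'rV[R]_n.+1 := lsubmx x.

Definition C1 (v : 'rV[R]_n.+1 -> R) : Prop :=
  forall i : 'I_n.+1,
    (forall x, derivable v x (delta_mx ord0 i)) /\
    continuous ('D_(delta_mx ord0 i) v).

Definition BorelK := g_sigma_algebraType (open : set (set 'rV[R]_K)).

Definition weak_constraint (p : nat) (fh : 'I_n -> {mpoly R[K]})
    (v : 'rV[R]_n.+1 -> R) (x : 'rV[R]_K) : R :=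
  'D_(delta_mx ord0 ord0) v (typart x) * x ord0 iw0 ^+ p
  + \sum_(j < n) 'D_(delta_mx ord0 (lift ord0 j)) v (typart x) * evalK (fh j) x.

Definition pF (t0 tf : R) (y0 yf : 'rV[R]_n) (Y : set 'rV[R]_n) (p : nat)
    (lh : {mpoly R[K]}) (fh : 'I_n -> {mpoly R[K]}) : \bar R :=
  let G := Gset t0 tf Y p in
  ereal_inf [set (\int[mu]_(x in G) (evalK lh x)%:E)%E |
    mu in [set mu : {measure set BorelK -> \bar R} |
             (mu setT < +oo)%E /\ mu (~` G) = 0%E /\
             forall v, C1 v ->
               (\int[mu]_(x in G) (weak_constraint p fh v x)%:E)%E
               = (v (pt tf yf) - v (pt t0 y0))%:E]].

Definition ell (z : 'X_{1..K} -> R) (h : {mpoly R[K]}) : R :=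
  \sum_(b <- msupp h) h@_b * z b.

Definition vmon (a : 'X_{1..n.+1}) : 'X_{1..K} :=
  [multinom match fintype.split i with inl c => a c | inr _ => 0%N end | i < K].

Definition Lpoly (p : nat) (fh : 'I_n -> {mpoly R[K]}) (a : 'X_{1..n.+1})
    : {mpoly R[K]} :=
  mderiv it 'X_[vmon a] * 'X_iw0 ^+ p
  + \sum_(j < n) mderiv (iy j) 'X_[vmon a] * fh j.

Definition bval (t0 tf : R) (y0 yf : 'rV[R]_n) (a : 'X_{1..n.+1}) : R :=
  ('X_[a] : {mpoly R[n.+1]}).@[fun i => pt tf yf ord0 i]
  - ('X_[a] : {mpoly R[n.+1]}).@[fun i => pt t0 y0 ord0 i].

(* the localizing matrix M_e(g z), indexed by monomials of degree <= e,
   is positive semidefinite *)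
Definition loc_psd (e : nat) (g : {mpoly R[K]}) (z : 'X_{1..K} -> R) : Prop :=
  forall xi : 'X_{1..K} -> R,
    0 <= \sum_(a : 'X_{1..K < e.+1}) \sum_(b : 'X_{1..K < e.+1})
           xi a * xi b * ell z (g * 'X_[(a : 'X_{1..K}) + b]).

Definition halfdeg (g : {mpoly R[K]}) : nat := uphalf (msize g).-1.

Definition feas_d (d : nat) (t0 tf : R) (y0 yf : 'rV[R]_n) (p : nat)
    (fh : 'I_n -> {mpoly R[K]}) (nG : nat) (g : 'I_nG.+1 -> {mpoly R[K]})
    (z : 'X_{1..K} -> R) : Prop :=
  (forall a : 'X_{1..n.+1}, (msize (Lpoly p fh a) <= (2 * d).+1)%N ->
     ell z (Lpoly p fh a) = bval t0 tf y0 yf a) /\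
  (forall i, loc_psd (d - halfdeg (g i)) (g i) z).

Definition pd (d : nat) (t0 tf : R) (y0 yf : 'rV[R]_n) (p : nat)
    (lh : {mpoly R[K]}) (fh : 'I_n -> {mpoly R[K]})
    (nG : nat) (g : 'I_nG.+1 -> {mpoly R[K]}) : \bar R :=
  ereal_inf [set (ell z lh)%:E | z in feas_d d t0 tf y0 yf p fh g].

Definition feas_inf (t0 tf : R) (y0 yf : 'rV[R]_n) (p : nat)
    (fh : 'I_n -> {mpoly R[K]}) (nG : nat) (g : 'I_nG.+1 -> {mpoly R[K]})
    (z : 'X_{1..K} -> R) : Prop :=
  (forall a : 'X_{1..n.+1}, ell z (Lpoly p fh a) = bval t0 tf y0 yf a) /\
  (forall i d, loc_psd d (g i) z).

Definition pinf (t0 tf : R) (y0 yf : 'rV[R]_n) (p : nat)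
    (lh : {mpoly R[K]}) (fh : 'I_n -> {mpoly R[K]})
    (nG : nat) (g : 'I_nG.+1 -> {mpoly R[K]}) : \bar R :=
  ereal_inf [set (ell z lh)%:E | z in feas_inf t0 tf y0 yf p fh g].

Definition deg_bounded (d : nat) (lh : {mpoly R[K]}) (fh : 'I_n -> {mpoly R[K]})
    (nG : nat) (g : 'I_nG.+1 -> {mpoly R[K]}) : Prop :=
  (msize lh <= (2 * d).+1)%N /\ (forall j, msize (fh j) <= (2 * d).+1)%N /\
  (forall i, msize (g i) <= (2 * d).+1)%N.

End Defs.

(* Main.v *)
Require Import Defs.
From HB Require Import structures.
From mathcomp Require Import all_boot all_order all_algebra.
From mathcomp Require Import finmap mpoly.
From mathcomp Require Import all_classical all_reals all_analysis.
From mathcomp Require Import measurable_realfun ring lra zify.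
Import Order.TTheory GRing.Theory Num.Theory.
Import numFieldNormedType.Exports.
Set Implicit Arguments.
Unset Strict Implicit.
Unset Printing Implicit Defensive.
Local Open Scope ring_scope.
Local Open Scope classical_set_scope.

(* The inequalities are inclusions of feasible sets, and the moments of a
   feasible measure are feasible, so only the construction of a measure from a
   feasible sequence z is at stake.  Let L be the linear functional with
   moments z; it is nonnegative on g_i times squares.

   - The ball constraint bounds L (x_j^2 s^2) by rho L (s^2), and this property
     passes from L to h |-> L ((r + x_i) h) and h |-> L ((r - x_i) h) when
     r^2 > rho; so L is nonnegative on all products of factors r + x_i, r - x_i.
   - Hence the Bernstein polynomials of degree M on the box [-r, r]^N give
     discrete measures sum_nu L (B_nu) delta_nu, whose integrals of a polynomial
     h converge to L h.  Their limit along an ultrafilter is a finitely additive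
     measure nu on all subsets; the outer measure generated by nu on open sets
     is a metric outer measure, so it is a Borel measure mu, and the layer cake
     formula gives int h dmu = L h.
   - Testing L (g_i q^2) >= 0 on q = (C - g_i)^k with k large shows that mu
     does not charge {g_i < 0}.
   - The weak equation, known for polynomial v, extends to all C^1 functions
     because applying Bernstein operators one coordinate at a time approximates
     a C^1 function together with its partial derivatives. *)

(** * Finitely additive measures to Borel measures *)

Section OpenRegularization.
Variables (R : realType) (T : normedModType R) (nu : set T -> R).
Hypothesis nu_ge0 : forall A, 0 <= nu A.
Hypothesis nuU : forall A B, A `&` B = set0 -> nu (A `|` B) = nu A + nu B.

Local Notation borel := (g_sigma_algebraType (@open T)).
Local Open Scope ereal_scope.

Lemma fadd0 : nu set0 = 0%R.
Proof. by have := nuU (setI0 set0); rewrite setU0; lra. Qed.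

Lemma fadd_le (A B : set T) : A `<=` B -> (nu A <= nu B)%R.
Proof.
move=> AB; rewrite -(setDUK AB) nuU ?setDIK//.
by rewrite lerDl.
Qed.

Lemma fadd_subU (A B : set T) : (nu (A `|` B) <= nu A + nu B)%R.
Proof.
have -> : A `|` B = A `|` (B `\` A) by rewrite setDE setUIr setUv setIT.
by rewrite nuU ?setDIK// lerD2l; apply: fadd_le; exact: subDsetl.
Qed.

(** Outer regularisation of [nu] by open sets; it is finite because [nu] takes real values, also on
    the whole space. *)
Definition open_hull (A : set T) : \bar R :=
  ereal_inf [set (nu U)%:E | U in [set U | open U /\ A `<=` U]].

Lemma open_hull_ge0 A : 0 <= open_hull A.
Proof. by apply/ereal_infP => _ [U _ <-]; rewrite lee_fin. Qed.

Lemma open_hull_le A U : open U -> A `<=` U -> open_hull A <= (nu U)%:E.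
Proof. by move=> oU AU; apply: ereal_inf_lbound; exists U. Qed.

Lemma open_hull0 : open_hull set0 = 0.
Proof.
apply/eqP; rewrite eq_le open_hull_ge0 andbT.
by rewrite (le_trans (open_hull_le open0 _))// fadd0.
Qed.

Lemma open_hull_fin A : open_hull A \is a fin_num.
Proof.
rewrite ge0_fin_numE ?open_hull_ge0//.
by rewrite (le_lt_trans (open_hull_le openT _))// ltry.
Qed.

(** [mu_ext] takes countable covers by Borel sets, and [open_hull] weighs each of them by its open
    supersets. This builds in the countable subadditivity that a finitely additive [nu] may lack. *)
Definition reg : set borel -> \bar R := mu_ext (open_hull : set borel -> _).

Lemma reg_ge0 A : 0 <= reg A.
Proof. by apply: mu_ext_ge0; exact: open_hull_ge0. Qed.

HB.instance Definition _ := isOuterMeasure.Build R borel reg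
  (@mu_ext0 _ borel _ _ open_hull0 open_hull_ge0) reg_ge0
  (@le_mu_ext _ borel _ open_hull)
  (@mu_ext_sigma_subadditive _ borel _ _ open_hull_ge0).

Lemma reg_open_le (U : set T) : open U -> reg U <= (nu U)%:E.
Proof.
move=> oU; apply: le_trans (open_hull_le oU (@subset_refl _ U)).
apply: ereal_inf_lbound; exists (fun k => if k is 0%N then U else set0).
  split=> [[|i]|x Ux] //; last by exists 0%N.
  by apply: sub_sigma_algebra.
rewrite nneseries_recl//; last by move=> *; exact: open_hull_ge0.
rewrite eseries0 ?adde0// => -[|i]//= _ _; exact: open_hull0.
Qed.

Definition thicken (A : set T) (e : R) : set T :=
  interior [set x | exists2 a, A a & ball a e x].

Lemma thicken_open A e : open (thicken A e).
Proof. exact: open_interior. Qed.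

Lemma sub_thicken A e : (0 < e)%R -> A `<=` thicken A e.
Proof.
move=> e0 x Ax; rewrite /thicken /interior /=.
by apply/nbhs_ballP; exists e => //= y xy; exists x.
Qed.

Definition separated (A B : set T) :=
  exists2 e : R, (0 < e)%R & forall a b, A a -> B b -> ~ ball a e b.

(** The thickenings of [A] and [B] by [e / 2] are disjoint open sets. Intersecting a cover with them
    gives a cover of [A] and a cover of [B], and additivity of [nu] on the disjoint pieces compares
    the sums. So [reg] is a metric outer measure. *)
Lemma reg_separated (A B : set T) :
  separated A B -> reg A + reg B <= reg (A `|` B).
Proof.
move=> [e e0 sep]; apply/ereal_infP => _ [F [mF cF] <-].
have e20 : (0 < e / 2)%R by rewrite divr_gt0.
set A' := thicken A (e / 2); set B' := thicken B (e / 2).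
have dAB : A' `&` B' = set0.
  apply/seteqP; split=> // x [/interior_subset[a Aa ax] /interior_subset[b Bb bx]].
  apply: (sep a b Aa Bb); rewrite (splitr e).
  by apply: (ball_triangle ax); exact: ball_sym.
have cov X : open X -> reg (X `&` (A `|` B)) <= \sum_(k <oo) open_hull (F k `&` X).
  move=> oX; apply: ereal_inf_lbound; exists (fun k => F k `&` X) => //.
  split=> [k|x [Xx /cF[k _ Fk]]]; last by exists k.
  by apply: measurableI => //; exact: sub_sigma_algebra.
have oA := thicken_open A (e / 2); have oB := thicken_open B (e / 2).
apply: (@le_trans _ _ (\sum_(k <oo) open_hull (F k `&` A') +
                       \sum_(k <oo) open_hull (F k `&` B'))).
  apply: leeD; (apply: le_trans; last by [apply: (cov _ oA)|apply: (cov _ oB)]);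
    apply: (le_outer_measure reg) => x ?; split; try exact: sub_thicken.
  by left. by right.
rewrite -nneseriesD; try by move=> *; exact: open_hull_ge0.
apply: lee_nneseries => [i _ _|i _]; first by rewrite adde_ge0 ?open_hull_ge0.
apply/ereal_infP => _ [U [oU FU] <-].
apply: (@le_trans _ _ ((nu (U `&` A'))%:E + (nu (U `&` B'))%:E)).
  by apply: leeD; apply: open_hull_le;
    [exact: openI|exact: setSI|exact: openI|exact: setSI].
rewrite -EFinD lee_fin -nuU; last by rewrite setIACA dAB setI0.
by apply: fadd_le => x [[]|[]].
Qed.

(** Caratheodory's criterion for metric outer measures: [A n] collects the points of [X] at distance
    at least [1 / (n + 1)] from [F], and what it misses outside [F] is covered by the tail of a
    convergent series of shells [S k]. *)
Lemma reg_cara_closed (F : set T) : closed F -> reg.-caratheodory F.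
Proof.
move=> cF; apply: le_caratheodory_measurable => X.
have [Xoo|Xfin] := eqVneq (reg X) +oo.
  by apply: (le_trans (leey _)); rewrite -Xoo.
have {}Xfin : reg X < +oo by rewrite ltey.
pose A n := [set x | X x /\ forall y, F y -> ~ ball x n.+1%:R^-1 y].
have AS n : A n `<=` A n.+1.
  move=> x [Xx h]; split=> // y Fy b; apply: (h y Fy).
  by apply: le_ball b; rewrite lef_pV2 ?posrE// ler_nat.
have AX n : A n `<=` X by move=> x [].
pose S n := A n.+1 `\` A n.
have sepF n : separated (X `&` F) (A n).
  exists n.+1%:R^-1%R; first by rewrite invr_gt0.
  by move=> a b [_ Fa] [Xb h] /ball_sym; exact: h.
have sepS n : separated (A n) (S n.+1).
  exists (n.+1%:R^-1 - n.+2%:R^-1)%R.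
    by rewrite subr_gt0 ltf_pV2 ?posrE// ltr_nat.
  move=> a b [Xa ha] [[Xb _] nb] ab; apply: nb; split=> // y Fy byy.
  apply: (ha y Fy); have := ball_triangle ab byy.
  by rewrite subrK.
have regA n : reg (A n) <= reg X by exact: le_outer_measure.
have rge0 (Z : set T) : 0 <= reg Z by exact: reg_ge0.
(* [A n] and [S n.+1] are separated and both lie in [A n.+2], so adding a shell advances one term on
   the right by two indices. One induction thus handles even and odd shells together. *)
have telesc n : \sum_(0 <= k < n) reg (S k.+1) <= reg (A n) + reg (A n.+1).
  elim: n => [|n IH]; first by rewrite big_nil adde_ge0.
  rewrite big_nat_recr//=; apply: le_trans (leeD2r _ IH) _.
  rewrite addeAC (addeC (reg (A n.+1))); apply: leeD2r.
  apply: le_trans (reg_separated (sepS n)) _.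
  by apply: le_outer_measure => x [|[]//]; move=> /AS/AS.
have sumS : \sum_(k <oo) reg (S k) < +oo.
  rewrite nneseries_recl//; apply: lte_add_pinfty.
    by apply: le_lt_trans Xfin; apply: le_outer_measure => x [/AX].
  rewrite -(nneseries_addn (f := fun k => reg (S k)) 1)//.
  have XX : reg X + reg X < +oo by rewrite lte_add_pinfty.
  apply: le_lt_trans XX.
  apply: lime_le; first by apply: is_cvg_nneseries => *; exact: rge0.
  near=> n; apply: le_trans (leeD (regA n) (regA n.+1)).
  by under eq_bigr do rewrite addn1; exact: telesc.
apply/lee_addgt0Pr => e e0.
have /(_ (ltac:(move=> *; exact: rge0))) := @nneseries_tail_cvg _ _ xpredT sumS.
move=> /fine_cvgP[finS /cvgrPdist_le/(_ e e0) near0].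
near \oo => n.
have tail : \sum_(n <= k <oo) reg (S k) <= e%:E.
  have fn : \sum_(n <= k <oo) reg (S k) \is a fin_num by near: n.
  have : (`|0 - fine (\sum_(n <= k <oo) reg (S k))| <= e)%R by near: n.
  rewrite sub0r normrN ger0_norm; last first.
    by rewrite fine_ge0// nneseries_ge0.
  by rewrite -lee_fin fineK.
(* Closedness of [F] enters here: a point of [X] outside [F] has positive distance from it, so it
   lies in some [A k], hence in [A n] or in a shell of index at least [n]. *)
have step : reg (X `&` ~` F) <= reg (A n) + \sum_(n <= k <oo) reg (S k).
  apply: le_trans (leeD2l _ (outer_measure_sigma_subadditive_tail reg n S)).
  apply: le_trans (outer_measureU2 reg _ _).
  apply: le_outer_measure => x [Xx nFx].
  have [k Ak] : exists k, A k x.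
    have : nbhs x (~` F) by apply: open_nbhs_nbhs; split=> //; exact: closed_openC.
    move=> /nbhs_ballP[d /= d0 dF].
    have [k _ kd] := near_infty_natSinv_lt (PosNum d0).
    exists k; split=> // y Fy xy; apply: (dF y _ Fy).
    by apply: le_ball xy; apply: ltW; apply: kd => /=.
  have [An|An] := pselect (A n x); first by left.
  right; have nk : (n <= k)%N.
    rewrite leqNgt; apply/negP => kn; apply: An.
    by rewrite -(subnK (ltnW kn)); elim: (n - k)%N => // i /AS; rewrite addSn.
  move: Ak; rewrite -(subnK nk); elim: (k - n)%N => [|i IH] //.
  rewrite addSn => h; have [Ai|Ai] := pselect (A (i + n)%N x); first exact: IH.
  by exists (i + n)%N => //=; apply/negP; rewrite -leqNgt leq_addl.
apply: le_trans (leeD2l _ step) _.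
rewrite addeA; apply: leeD => //.
apply: le_trans (reg_separated (sepF n)) _.
by apply: le_outer_measure => x [[]|[]].
Unshelve. all: by end_near. Qed.

Lemma reg_cara_measurable (B : set borel) : measurable B -> reg.-caratheodory B.
Proof.
apply: smallest_sub; last first.
  move=> U oU; rewrite -(setCK U); apply: caratheodory_measurable_setC.
  by apply: reg_cara_closed; exact: open_closedC.
split; first exact: caratheodory_measurable_set0.
  by move=> A mA; rewrite setTD; exact: caratheodory_measurable_setC.
by move=> A mA; exact: caratheodory_measurable_bigcup.
Qed.

Let reg0 : reg set0 = 0. Proof. exact: outer_measure0. Qed.

Let reg_sigma_additive : semi_sigma_additive reg.
Proof.
move=> F mF tF mUF; apply: (@caratheodory_measure_sigma_additive _ _ reg) => //.
- by move=> i; exact: reg_cara_measurable.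
- exact: reg_cara_measurable.
Qed.

HB.instance Definition _ := isMeasure.Build _ borel R reg
  reg0 reg_ge0 reg_sigma_additive.

(** A countable cover is enlarged to an open one at total cost [e]; compactness leaves finitely many
    sets, for which finite subadditivity of [nu] suffices. *)
Lemma reg_compact_ge (C : set T) : compact C -> (nu C)%:E <= reg C.
Proof.
rewrite compact_cover => cC; apply/ereal_infP => _ [F [mF cF] <-].
apply/lee_addgt0Pr => e e0.
have /choice[U UP] : forall k, exists U : set T, [/\ open U, F k `<=` U &
    (nu U)%:E <= open_hull (F k) + (e / (2 ^ k.+1)%:R)%:E].
  move=> k; have e'0 : (0 < e / (2 ^ k.+1)%:R)%R.
    by rewrite divr_gt0// ltr0n expn_gt0.
  have [_ [U [oU FU] <-] h] := lb_ereal_inf_adherent e'0 (open_hull_fin (F k)).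
  by exists U; split=> //; exact: ltW.
have [||D _ DC] := cC nat setT U.
- by move=> i _; have [] := UP i.
- by move=> x /cF[k _ Fk]; exists k => //; have [_ + _] := UP k; exact.
apply: le_trans (epsilon_trick xpredT (fun k => open_hull_ge0 (F k)) (ltW e0)).
have [N DN] : exists N, forall k, k \in D -> (k < N)%N.
  exists (\max_(k <- D) k).+1 => k kD; rewrite ltnS.
  by rewrite (big_fsetD1 k)//= leq_maxl.
apply: le_trans (nneseries_lim_ge N _); last first.
  by move=> i _ _; rewrite adde_ge0 ?open_hull_ge0// lee_fin divr_ge0// ltW.
apply: (@le_trans _ _ (\sum_(0 <= k < N) (nu (U k))%:E)); last first.
  by apply: lee_sum => k _; have [] := UP k.
rewrite sumEFin lee_fin.
apply: (@le_trans _ _ (nu (\big[setU/set0]_(0 <= k < N) U k))).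
  apply: fadd_le => x /DC[k /= kD Ux]; rewrite big_mkord.
  by rewrite -bigcup_mkord; exists k => //=; exact: DN.
elim: N {DN} => [|N IH]; first by rewrite !big_nil fadd0.
rewrite !big_nat_recr//=; apply: le_trans (fadd_subU _ _) _.
by rewrite lerD2r.
Qed.

(** [mu] and [nu] may differ on Borel sets; these one-sided bounds are what the computation of
    masses and the layer cake estimate rely on. *)
Lemma open_regularization :
  exists mu : {measure set borel -> \bar R},
    (forall U : set T, open U -> mu U <= (nu U)%:E) /\
    (forall C : set T, compact C -> (nu C)%:E <= mu C).
Proof.
by exists reg; split; [exact: reg_open_le|exact: reg_compact_ge].
Qed.

End OpenRegularization.

(** * Positivity on a box *)

Section BoxPositivity.
Variables (R : realType) (N : nat) (L : {scalar {mpoly R[N]}}).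

Lemma scalarMC (c : R) p : L (c%:MP * p) = c * L p.
Proof. by rewrite mul_mpolyC linearZ_LR. Qed.

(** The multiplier [q] stands for the functional [h |-> L (q * h)]; having it as a parameter lets
    positivity be propagated factor by factor. *)
Definition box_pos (rho : R) (q : {mpoly R[N]}) := forall s,
  0 <= L (q * s ^+ 2) /\ forall j, 0 <= L (q * (rho%:MP - 'X_j ^+ 2) * s ^+ 2).

Lemma ge0_geometric_bound (u C a : R) :
  0 <= a < 1 -> (forall k, - (a ^+ k * C) <= u) -> 0 <= u.
Proof.
move=> /andP[a0 a1] h.
have c0 : (fun k => - (a ^+ k * C)) @ \oo --> - (0 * C).
  apply: cvgN; apply: cvgMl; apply: cvg_expr; by rewrite ger0_norm.
rewrite mul0r oppr0 in c0.
by apply: (cvgr_to_le c0); exact: nearW.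
Qed.

Section LinearFactor.
Variables (rho r : R) (q : {mpoly R[N]}).
Hypotheses (rho0 : 0 <= rho) (r0 : 0 < r) (rho_r : rho < r ^+ 2).
Hypothesis q_pos : box_pos rho q.

Lemma box_pos_ge0 s : 0 <= L (q * s ^+ 2).
Proof. exact: (q_pos s).1. Qed.

Lemma box_pos_widen i s : 0 <= L (q * ((r ^+ 2)%:MP - 'X_i ^+ 2) * s ^+ 2).
Proof.
have -> : q * ((r ^+ 2)%:MP - 'X_i ^+ 2) * s ^+ 2 =
    q * (rho%:MP - 'X_i ^+ 2) * s ^+ 2 + (r ^+ 2 - rho)%:MP * (q * s ^+ 2).
  by rewrite mpolyCB; ring.
rewrite linearD /= scalarMC addr_ge0 ?(q_pos s).2// mulr_ge0 ?box_pos_ge0//.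
by rewrite subr_ge0 ltW.
Qed.

Let y i : {mpoly R[N]} := (r^-1)%:MP * 'X_i.
Let theta := rho / r ^+ 2.

Let theta01 : 0 <= theta < 1.
Proof.
by rewrite /theta divr_ge0 ?sqr_ge0//= ltr_pdivrMr ?exprn_gt0// mul1r.
Qed.

(** At [y i ^+ k * s], the second half of [box_pos] says that one more factor [(X_i / r)^2] costs a
    factor [theta < 1]. *)
Let powers_decay i k s :
  0 <= L (q * (y i ^+ 2) ^+ k * s ^+ 2) <= theta ^+ k * L (q * s ^+ 2).
Proof.
have sq j : q * (y i ^+ 2) ^+ j * s ^+ 2 = q * (y i ^+ j * s) ^+ 2.
  by rewrite -exprM mulnC exprM; ring.
rewrite sq box_pos_ge0 /=; elim: k => [|k IH]; first by rewrite !expr0 !mul1r.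
rewrite [theta ^+ _]exprS -mulrA.
apply: le_trans (ler_wpM2l _ IH); last by case/andP: theta01.
have := (q_pos (y i ^+ k * s)).2 i.
set w := _ ^+ k * s.
have -> : q * (rho%:MP - 'X_i ^+ 2) * w ^+ 2 =
    rho%:MP * (q * w ^+ 2) - q * 'X_i ^+ 2 * w ^+ 2 by ring.
have -> : q * (y i ^+ k.+1 * s) ^+ 2 =
    (r^-1 ^+ 2)%:MP * (q * 'X_i ^+ 2 * w ^+ 2).
  by rewrite [y i ^+ k.+1]exprS -mulrA -/w /y rmorphXn /=; ring.
rewrite linearB /= !scalarMC subr_ge0 => h.
have -> : theta * L (q * w ^+ 2) = r^-1 ^+ 2 * (rho * L (q * w ^+ 2)).
  by rewrite /theta exprVn; ring.
by rewrite ler_wpM2l// sqr_ge0.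
Qed.

(* [1 - a = (1 - a)^2 (1 + a + ... + a^(k-1)) + a^k (1 - a)] exhibits
   [1 - a], [a = (x/r)^2], as a sum of squares up to a remainder that tends to 0. *)
Let pos_prod i j s :
  0 <= L (q * (rho%:MP - 'X_j ^+ 2) * (1 - y i ^+ 2) * s ^+ 2).
Proof.
pose G := rho%:MP - 'X_j ^+ 2 : {mpoly R[N]}.
pose u k := L (q * (y i ^+ 2) ^+ k * (G * (1 - y i ^+ 2) * s ^+ 2)).
(* The difference of consecutive terms is [L] of [q * G] times a square. Hence [u 0], the quantity
   of interest, bounds every [u k] from above. *)
have uS k : u k.+1 <= u k.
  have -> : u k = u k.+1 + L (q * G * (y i ^+ k * (1 - y i ^+ 2) * s) ^+ 2).
    rewrite /u -linearD /=; congr (L _).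
    rewrite [(y i ^+ 2) ^+ k.+1]exprS.
    have -> : (y i ^+ 2) ^+ k = (y i ^+ k) ^+ 2 by rewrite -exprM mulnC exprM.
    by ring.
  by rewrite lerDl; exact: (q_pos _).2.
have u0k k : u k <= u 0%N.
  by elim: k => // k IH; exact: le_trans (uS k) IH.
have -> : L (q * G * (1 - y i ^+ 2) * s ^+ 2) = u 0%N.
  by rewrite /u expr0 mulr1; congr (L _); ring.
pose h := G * (1 - y i ^+ 2) * s ^+ 2.
apply: (@ge0_geometric_bound _ (4^-1 * L (q * (1 - h) ^+ 2)) theta) => // k.
apply: le_trans (u0k k).
(* Polarization, [4 h = (1 + h)^2 - (1 - h)^2]: by [powers_decay] the first term is nonnegative and
   the subtracted one is at most a multiple of [theta ^+ k]. *)
have -> : u k = 4^-1 * (L (q * (y i ^+ 2) ^+ k * (1 + h) ^+ 2) -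
                        L (q * (y i ^+ 2) ^+ k * (1 - h) ^+ 2)).
  rewrite -linearB /= -scalarMC /u -/h; congr (L _).
  have e4 : (4^-1 : R)%:MP * 4%:R = 1 :> {mpoly R[N]}.
    by rewrite -mpolyC_nat -mpolyCM mulVf ?mpolyC1// pnatr_eq0.
  transitivity ((4^-1 : R)%:MP * 4%:R * (q * (y i ^+ 2) ^+ k * h)).
    by rewrite e4 mul1r.
  by ring.
have /andP[p1 _] := powers_decay i k (1 + h).
have /andP[_ p2] := powers_decay i k (1 - h).
by lra.
Qed.

(** For [l = r + e X_i] with [e^2 = 1], the identity [2 r l = l^2 + (r^2 - X_i^2)] replaces the
    factor [l] by a square plus a box constraint. Products of two box constraints are handled by
    [pos_prod]. *)
Lemma box_pos_linear_factor i (e : R) : e ^+ 2 = 1 ->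
  box_pos rho (q * (r%:MP + e%:MP * 'X_i)).
Proof.
move=> e1; set l := r%:MP + _.
have r20 : 0 < (2 * r)^-1 by rewrite invr_gt0 mulr_gt0.
have dbl : l = ((2 * r)^-1)%:MP * (l ^+ 2 + ((r ^+ 2)%:MP - 'X_i ^+ 2)).
  have -> : l ^+ 2 + ((r ^+ 2)%:MP - 'X_i ^+ 2) = (2 * r)%:MP * l.
    have E1 : (e%:MP) ^+ 2 = 1 :> {mpoly R[N]} by rewrite -rmorphXn /= e1 mpolyC1.
    rewrite /l rmorphXn rmorphM /= mpolyC_nat.
    transitivity ((2%:R * r%:MP) * (r%:MP + e%:MP * 'X_i) +
      (e%:MP ^+ 2 - 1) * 'X_i ^+ 2); first by ring.
    by rewrite E1; ring.
  by rewrite mulrA -mpolyCM mulVf ?mpolyC1 ?mul1r// mulf_neq0 ?pnatr_eq0// gt_eqF.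
move=> s; split=> [|j].
  have -> : q * l * s ^+ 2 = ((2 * r)^-1)%:MP *
      (q * (l * s) ^+ 2 + q * ((r ^+ 2)%:MP - 'X_i ^+ 2) * s ^+ 2).
    by rewrite {1}dbl exprMn; ring.
  rewrite scalarMC mulr_ge0 ?(ltW r20)// linearD /= addr_ge0 ?box_pos_ge0//.
  exact: box_pos_widen.
have -> : q * l * (rho%:MP - 'X_j ^+ 2) * s ^+ 2 = ((2 * r)^-1)%:MP *
    (q * (rho%:MP - 'X_j ^+ 2) * (l * s) ^+ 2 + 
     (r ^+ 2)%:MP * (q * (rho%:MP - 'X_j ^+ 2) * (1 - y i ^+ 2) * s ^+ 2)).
  have -> : (r ^+ 2)%:MP * (q * (rho%:MP - 'X_j ^+ 2) * (1 - y i ^+ 2) * s ^+ 2)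
     = q * (rho%:MP - 'X_j ^+ 2) * ((r ^+ 2)%:MP - 'X_i ^+ 2) * s ^+ 2.
    have -> : (r ^+ 2)%:MP - 'X_i ^+ 2 = (r ^+ 2)%:MP * (1 - y i ^+ 2).
      have E1 : (r%:MP) * (r^-1)%:MP = 1 :> {mpoly R[N]}.
        by rewrite -mpolyCM mulfV ?mpolyC1// gt_eqF.
      rewrite /y rmorphXn /=.
      transitivity (r%:MP ^+ 2 - (r%:MP * (r^-1)%:MP) ^+ 2 * 'X_i ^+ 2).
        by rewrite E1; ring.
      by ring.
    by ring.
  by rewrite {1}dbl exprMn; ring.
rewrite scalarMC mulr_ge0 ?(ltW r20)// linearD /= addr_ge0 ?(q_pos _).2//.
by rewrite scalarMC mulr_ge0 ?sqr_ge0.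
Qed.

End LinearFactor.

(** Quantifying over every multiplier [q] makes the property closed under products. *)
Definition box_stable (rho : R) (f : {mpoly R[N]}) :=
  forall q, box_pos rho q -> box_pos rho (q * f).

Lemma box_stable1 rho : box_stable rho 1.
Proof. by move=> q; rewrite mulr1. Qed.

Lemma box_stableM rho f g :
  box_stable rho f -> box_stable rho g -> box_stable rho (f * g).
Proof. by move=> sf sg q /sf/sg; rewrite mulrA. Qed.

Lemma box_stableX rho f k : box_stable rho f -> box_stable rho (f ^+ k).
Proof.
move=> sf; elim: k => [|k IH]; first by rewrite expr0; exact: box_stable1.
by rewrite exprS; exact: box_stableM.
Qed.

Lemma box_stableC rho (c : R) : 0 <= c -> box_stable rho c%:MP.
Proof.
move=> c0 q qpos s; split=> [|j].
  have -> : q * c%:MP * s ^+ 2 = c%:MP * (q * s ^+ 2) by ring.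
  by rewrite scalarMC mulr_ge0// (qpos s).1.
have -> : q * c%:MP * (rho%:MP - 'X_j ^+ 2) * s ^+ 2 =
  c%:MP * (q * (rho%:MP - 'X_j ^+ 2) * s ^+ 2) by ring.
by rewrite scalarMC mulr_ge0// (qpos s).2.
Qed.

End BoxPositivity.

(** * Bernstein polynomials and the discrete measures they define *)

Section BernsteinBasis.

(** The ring is arbitrary because the argument [t] will itself be a polynomial. *)
Definition bern (A : comNzRingType) (M k : nat) (t : A) : A :=
  t ^+ k * (1 - t) ^+ (M - k) *+ 'C(M, k).

(** These are the factorial moments of the binomial law; the induction on [k] rests on the
    absorption identity [j C(M, j) = M C(M - 1, j - 1)]. *)
Lemma bern_ffact (A : comNzRingType) (t : A) k M :
  \sum_(j < M.+1) (j ^_ k)%:R * bern M j t = (M ^_ k)%:R * t ^+ k.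
Proof.
elim: k M => [|k IH] M.
  rewrite ffactn0 expr0 mulr1 -[RHS](expr1n _ M) -{2}(subrK t 1) exprDn.
  by apply: eq_bigr => j _; rewrite ffactn0 mul1r /bern mulrC.
case: M => [|M]; first by rewrite big_ord1 /= !ffact0n !mul0r.
rewrite big_ord_recl /= ffact0n mul0r add0r ffactSS natrM exprS.
have -> : M.+1%:R * (M ^_ k)%:R * (t * t ^+ k) =
  M.+1%:R * t * ((M ^_ k)%:R * t ^+ k) by ring.
rewrite -IH big_distrr /=; apply: eq_bigr => j _.
rewrite /bump /= add1n ffactSS natrM /bern subSS exprS.
rewrite -[_ *+ 'C(M.+1, _)]mulr_natr -[_ *+ 'C(M, _)]mulr_natr.
have /(congr1 (fun n => n%:R : A)) := mul_bin_diag M.+1 j; rewrite /= !natrM => E.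
transitivity ((j ^_ k)%:R * t * t ^+ j * (1 - t) ^+ (M - j) *
  (j.+1%:R * 'C(M.+1, j.+1)%:R)); first by ring.
by rewrite -E; ring.
Qed.

Lemma bern_sum1 (A : comNzRingType) (t : A) M : \sum_(j < M.+1) bern M j t = 1.
Proof.
have := bern_ffact t 0 M; rewrite ffactn0 expr0 mulr1 => E.
by rewrite -[RHS]E; apply: eq_bigr => j _; rewrite ffactn0 mul1r.
Qed.

(** Passing from [k] to [k + 1] multiplies the ratio by [(j - k) / (M - k)] and the power by
    [j / M]. These factors differ by at most [k / M], and [k^2 + k <= (k + 1)^2]. *)
Lemma ffact_ratio_dist (R : realType) (M j k : nat) :
  (j <= M)%N -> (k <= M)%N ->
  `|(j ^_ k)%:R / (M ^_ k)%:R - (j%:R / M%:R) ^+ k| <= (k ^ 2)%:R / M%:R :> R.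
Proof.
move=> jM; elim: k => [|k IH] kM.
  by rewrite !ffactn0 expr0 divr1 subrr normr0 divr_ge0.
have M0 : 0 < M%:R :> R by rewrite ltr0n; lia.
have Mk0 : 0 < (M - k)%:R :> R by rewrite ltr0n; lia.
rewrite !ffactnSr !natrM invfM exprSr.
set a := (j ^_ k)%:R; set b := (M ^_ k)%:R.
set c := (j%:R / M%:R) ^+ k; set x := (j - k)%:R; set z := (M - k)%:R.
have x01 : 0 <= x / z <= 1.
  rewrite divr_ge0//= ler_pdivrMr// mul1r ler_nat; lia.
have c01 : 0 <= c <= 1.
  by rewrite exprn_ge0 ?divr_ge0//= exprn_ile1 ?divr_ge0// ler_pdivrMr// mul1r ler_nat.
have -> : a * x * (b^-1 / z) - c * (j%:R / M%:R) =
  (a / b - c) * (x / z) + c * (x / z - j%:R / M%:R) by ring.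
apply: le_trans (ler_normD _ _) _.
rewrite (normrM (a / b - c)) (normrM c).
have d1 : `|x / z - j%:R / M%:R| <= k%:R / M%:R.
  (* If [j < k], the truncated difference [x] is 0 and [j / M] itself is below [k / M]. *)
  have [kj|jk] := leqP k j; last first.
    have -> : x = 0 by rewrite /x (_ : (j - k)%N = 0%N)//; lia.
    rewrite mul0r sub0r normrN ger0_norm ?divr_ge0//.
    by rewrite ler_wpM2r ?invr_ge0// ler_nat ltnW.
  have -> : x / z - j%:R / M%:R = - ((k%:R / M%:R) * ((M - j)%:R / z)).
    rewrite /x /z !natrB; try lia.
    have Mk0' : M%:R - k%:R != 0 :> R by rewrite -natrB ?gt_eqF//; lia.
    by field; rewrite Mk0' gt_eqF.
  have h0 : 0 <= (M - j)%:R / z by apply: divr_ge0; exact: ler0n.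
  have h1 : (M - j)%:R / z <= 1 by rewrite ler_pdivrMr// mul1r ler_nat; lia.
  have h2 : 0 <= k%:R / M%:R :> R by rewrite divr_ge0.
  rewrite normrN ger0_norm; last exact: mulr_ge0.
  exact: ler_piMr.
apply: (@le_trans _ _ ((k ^ 2)%:R / M%:R + k%:R / M%:R)).
  apply: lerD.
    apply: le_trans (IH _); last by lia.
    by rewrite ler_piMr// ger0_norm; case/andP: x01.
  apply: le_trans d1; rewrite ler_piMl// ger0_norm; by case/andP: c01.
rewrite -mulrDl ler_wpM2r ?invr_ge0// -natrD -natrM ler_nat; nia.
Qed.

Lemma prod_dist_le (R : realType) (I : Type) (s : seq I) (a b : I -> R) :
  (forall i, 0 <= a i <= 1) -> (forall i, 0 <= b i <= 1) ->
  `|\prod_(i <- s) a i - \prod_(i <- s) b i| <= \sum_(i <- s) `|a i - b i|.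
Proof.
move=> a01 b01; elim: s => [|i s IH]; first by rewrite !big_nil subrr normr0.
rewrite !big_cons.
set pa := \prod_(j <- s) a j; set pb := \prod_(j <- s) b j.
have -> : a i * pa - b i * pb = (a i - b i) * pb + a i * (pa - pb) by ring.
apply: le_trans (ler_normD _ _) _; rewrite !normrM; apply: lerD.
  have /andP[p0 p1] : 0 <= pb <= 1.
    apply/andP; split; first by apply: prodr_ge0 => j _; case/andP: (b01 j).
    by apply: prodr_ile1 => j _; exact: b01.
  by rewrite ler_piMr// ger0_norm.
apply: le_trans IH; case/andP: (a01 i) => a0 a1.
by rewrite ler_piMl// ger0_norm.
Qed.

End BernsteinBasis.

Section BernsteinFunctional.
Variables (R : realType) (N : nat) (L : {scalar {mpoly R[N]}}) (rho r : R).
Hypotheses (rho0 : 0 <= rho) (r0 : 0 < r) (rho_r : rho < r ^+ 2).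
Hypothesis L_pos : box_pos L rho 1.

Definition unit_coord (i : 'I_N) : {mpoly R[N]} :=
  ((2 * r)^-1)%:MP * (r%:MP + 'X_i).

Definition bern_prod M (nu : {ffun 'I_N -> 'I_M.+1}) : {mpoly R[N]} :=
  \prod_i bern M (nu i) (unit_coord i).

Definition bern_node M (nu : {ffun 'I_N -> 'I_M.+1}) : 'rV[R]_N :=
  \row_i (2 * r * ((nu i)%:R / M%:R) - r).

(** The integral of [f] against the discrete measure with mass [L (bern_prod nu)] at the point
    [bern_node nu]. *)
Definition bern_fun M (f : 'rV[R]_N -> R) : R :=
  \sum_(nu : {ffun 'I_N -> 'I_M.+1}) f (bern_node nu) * L (bern_prod nu).

Let r2 : 2 * r != 0.
Proof. by rewrite mulf_neq0 ?pnatr_eq0// gt_eqF. Qed.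

Let ir2 : 0 <= (2 * r)^-1.
Proof. by rewrite invr_ge0 mulr_ge0// ltW. Qed.

Lemma unit_coordC i :
  1 - unit_coord i = ((2 * r)^-1)%:MP * (r%:MP + (-1)%:MP * 'X_i).
Proof.
have E : 1 = ((2 * r)^-1)%:MP * (2%:R * r%:MP) :> {mpoly R[N]}.
  by rewrite -mpolyC_nat -!mpolyCM mulVf ?mpolyC1.
by rewrite /unit_coord {1}E mpolyCN mpolyC1; ring.
Qed.

(** Up to nonnegative constants, a Bernstein product is a product of factors [r + X_i] and
    [r - X_i], each of which preserves [box_pos]. *)
Lemma bern_prod_ge0 M (nu : {ffun 'I_N -> 'I_M.+1}) : 0 <= L (bern_prod nu).
Proof.
have st : box_stable L rho (bern_prod nu).
  apply: (big_ind (box_stable L rho)); first exact: box_stable1.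
    exact: box_stableM.
  move=> i _; rewrite /bern -mulr_natr -mpolyC_nat.
  apply: box_stableM; last by apply: box_stableC; rewrite ler0n.
  apply: box_stableM; apply: box_stableX; rewrite ?unit_coordC /unit_coord;
    (apply: box_stableM; first exact: box_stableC) => q qpos.
    rewrite (_ : r%:MP + 'X_i = r%:MP + 1%:MP * 'X_i); last first.
      by rewrite mpolyC1 mul1r.
    by apply: box_pos_linear_factor => //; rewrite expr1n.
  by apply: box_pos_linear_factor => //; rewrite sqrrN expr1n.
by have := (st 1 L_pos 1).1; rewrite mul1r expr1n mulr1.
Qed.

Lemma bern_prod_sum M : \sum_(nu : {ffun 'I_N -> 'I_M.+1}) bern_prod nu = 1.
Proof.
rewrite -(bigA_distr_bigA (fun i (j : 'I_M.+1) => bern M j (unit_coord i))).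
by rewrite big1// => i _; exact: bern_sum1.
Qed.

(** The factorial moments, taken in each coordinate, give the Bernstein coefficients of a monomial;
    by [ffact_ratio_dist] these are close to its values at the nodes. *)
Lemma bern_prod_monom M (a : 'X_{1..N}) : (forall i, a i <= M)%N ->
  \prod_i unit_coord i ^+ a i =
  \sum_(nu : {ffun 'I_N -> 'I_M.+1})
    (\prod_i ((nu i ^_ a i)%:R / (M ^_ a i)%:R))%:MP * bern_prod nu.
Proof.
move=> aM.
pose F i (j : 'I_M.+1) : {mpoly R[N]} :=
  ((j ^_ a i)%:R / (M ^_ a i)%:R)%:MP * bern M j (unit_coord i).
transitivity (\sum_(nu : {ffun 'I_N -> 'I_M.+1}) \prod_i F i (nu i)); last first.
  by apply: eq_bigr => nu _; rewrite rmorph_prod -big_split.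
rewrite -(bigA_distr_bigA F); apply: eq_bigr => i _.
have M0 : (M ^_ a i)%:R != 0 :> R by rewrite pnatr_eq0 -lt0n ffact_gt0.
transitivity (((M ^_ a i)%:R^-1)%:MP * ((M ^_ a i)%:R * unit_coord i ^+ a i)).
  by rewrite -mpolyC_nat mulrA -mpolyCM mulVf// mpolyC1 mul1r.
rewrite -bern_ffact big_distrr /=; apply: eq_bigr => j _.
by rewrite /F mulrA -mpolyC_nat -mpolyCM [_^-1 * _]mulrC.
Qed.

Local Notation ev h := (fun x : 'rV[R]_N => h.@[fun i => x ord0 i]).

Lemma unit_coord_node M (nu : {ffun 'I_N -> 'I_M.+1}) i :
  ev (unit_coord i) (bern_node nu) = (nu i)%:R / M%:R.
Proof.
rewrite /unit_coord mevalM mevalD !mevalC mevalXU mxE.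
by rewrite addrC subrK mulKf.
Qed.

Lemma bern_fun1 M : bern_fun M (fun=> 1) = L 1.
Proof.
by rewrite -(bern_prod_sum M) linear_sum; apply: eq_bigr => nu _; rewrite mul1r.
Qed.

Lemma bern_funD M f g :
  bern_fun M (fun x => f x + g x) = bern_fun M f + bern_fun M g.
Proof. by rewrite /bern_fun -big_split; apply: eq_bigr => nu _; rewrite mulrDl. Qed.

Lemma bern_funZ M c f : bern_fun M (fun x => c * f x) = c * bern_fun M f.
Proof. by rewrite /bern_fun big_distrr; apply: eq_bigr => nu _; rewrite /= mulrA. Qed.

Lemma bern_fun_le M f g : (forall nu : {ffun 'I_N -> 'I_M.+1},
    f (bern_node nu) <= g (bern_node nu)) -> bern_fun M f <= bern_fun M g.
Proof.
by move=> fg; apply: ler_sum => nu _; rewrite ler_wpM2r ?bern_prod_ge0.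
Qed.

Lemma bern_node_box M (nu : {ffun 'I_N -> 'I_M.+1}) i :
  - r <= bern_node nu ord0 i <= r.
Proof.
rewrite mxE; have : 0 <= ((nu i)%:R / M%:R : R) <= 1.
  rewrite divr_ge0//=; case: M nu => [|M] nu; first by rewrite invr0 mulr0.
  by rewrite ler_pdivrMr// mul1r ler_nat -ltnS ltn_ord.
move=> /andP[x0 x1]; set x := _ / _ in x0 x1 *.
have h0 : 0 <= r * x by rewrite mulr_ge0// ltW.
have h1 : r * x <= r by rewrite ler_piMr// ltW.
by apply/andP; split; lra.
Qed.

Lemma bern_fun_monom (a : 'X_{1..N}) :
  bern_fun M (ev (\prod_i unit_coord i ^+ a i)) @[M --> \oo]
    --> L (\prod_i unit_coord i ^+ a i).
Proof.
pose C := (\sum_i (a i ^ 2)%:R) * L 1.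
apply/cvgrPdist_le => e e0; near=> M.
have M0 : (0 < M)%N by near: M; exact: nbhs_infty_gt.
have aM i : (a i <= M)%N.
  apply: (@leq_trans (mdeg a)); last by near: M; exact: nbhs_infty_ge.
  by rewrite mdegE (bigD1 i)//= leq_addr.
have Ce : C / M%:R <= e.
  rewrite ler_pdivrMr ?ltr0n// mulrC -ler_pdivrMr//.
  by near: M; exact: nbhs_infty_ger.
apply: le_trans Ce.
(* The Bernstein products sum to 1, so the target bound is spread over the nodes and the estimate
   can be made node by node. *)
have -> : C / M%:R = \sum_(nu : {ffun 'I_N -> 'I_M.+1})
    L (bern_prod nu) * (M%:R^-1 * \sum_i (a i ^ 2)%:R).
  by rewrite -big_distrl /= -linear_sum bern_prod_sum /C; ring.
rewrite {1}(bern_prod_monom aM) linear_sum /bern_fun -sumrB.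
apply: le_trans (ler_norm_sum _ _ _) _; apply: ler_sum => nu _.
rewrite scalarMC -mulrBl normrM (ger0_norm (bern_prod_ge0 nu)) mulrC.
rewrite ler_wpM2l ?bern_prod_ge0//.
have -> : ev (\prod_i unit_coord i ^+ a i) (bern_node nu) =
    \prod_i ((nu i)%:R / M%:R) ^+ a i.
  by rewrite rmorph_prod; apply: eq_bigr => i _; rewrite rmorphXn /= unit_coord_node.
apply: le_trans (prod_dist_le _ _ _) _ => [i|i|].
- rewrite divr_ge0//= ler_pdivrMr ?mul1r ?ltr0n ?ffact_gt0// ler_nat.
  by rewrite !ffact_prod; apply: leq_prod => j _; apply: leq_sub2r; rewrite -ltnS.
- rewrite exprn_ge0 ?divr_ge0//= exprn_ile1 ?divr_ge0//.
  by rewrite ler_pdivrMr ?ltr0n// mul1r ler_nat -ltnS.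
rewrite mulrC big_distrl /=; apply: ler_sum => i _.
by apply: ffact_ratio_dist; rewrite ?aM// -ltnS.
Unshelve. all: by end_near. Qed.

(** The convergence is linear in [h], and [X_i = 2 r * unit_coord i - r] makes every polynomial a
    combination of the products treated in [bern_fun_monom]. *)
Lemma bern_fun_poly (h : {mpoly R[N]}) : bern_fun M (ev h) @[M --> \oo] --> L h.
Proof.
pose V (h : {mpoly R[N]}) := bern_fun M (ev h) @[M --> \oo] --> L h.
have V0 : V 0.
  rewrite /V linear0 [X in X @ _ --> _](_ : _ = fun=> 0); first exact: cvg_cst.
  apply/funext => M; rewrite /bern_fun big1// => nu _.
  by rewrite meval0 mul0r.
have VD p q : V p -> V q -> V (p + q).
  move=> Vp Vq; rewrite /V linearD.
  rewrite [X in X @ _ --> _](_ : _ = fun M => bern_fun M (ev p) + bern_fun M (ev q)).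
    exact: cvgD.
  apply/funext => M; rewrite -bern_funD; congr bern_fun.
  by apply/funext => x; rewrite mevalD.
have VZ c p : V p -> V (c *: p).
  move=> Vp; rewrite /V linearZ_LR.
  rewrite [X in X @ _ --> _](_ : _ = fun M => c * bern_fun M (ev p)).
    exact: cvgMr.
  apply/funext => M; rewrite -bern_funZ; congr bern_fun.
  by apply/funext => x; rewrite mevalZ.
have Vcomp p : V (p \mPo [tuple unit_coord i | i < N]).
  rewrite comp_mpolyE; apply: big_ind => // a _; apply: VZ.
  rewrite (eq_bigr (fun i => unit_coord i ^+ a i)); first exact: bern_fun_monom.
  by move=> i _; rewrite tnth_mktuple.
rewrite -/(V h) [h]mpolyE; apply: big_ind => // a _; apply: VZ.
have := Vcomp (\prod_i ((2 * r)%:MP * 'X_i - r%:MP) ^+ a i).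
rewrite rmorph_prod /= mpolyXE_id; congr V; apply: eq_bigr => i _.
rewrite rmorphXn rmorphB rmorphM /= !comp_mpolyC comp_mpolyXU -tnth_nth tnth_mktuple.
congr (_ ^+ _); rewrite /unit_coord mulrA -mpolyCM mulfV// mpolyC1; ring.
Qed.

End BernsteinFunctional.

(** * Representation on the box *)

Section BorelIntegration.

Lemma continuous_borel_measurable (R : realType) (T : ptopologicalType)
    (D : set (g_sigma_algebraType (@open T))) (f : T -> R) :
  measurable D -> continuous f ->
  measurable_fun D (f : g_sigma_algebraType (@open T) -> R).
Proof.
move=> mD cf; apply: (measurability _ (RGenOInfty.measurableE R)).
move=> _ [_ [a ->] <-]; apply: measurableI => //; apply: sub_sigma_algebra.
apply: open_comp => [x _|]; first exact: cf.
exact: interval_open.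
Qed.

Lemma closed_borel_measurable (T : ptopologicalType)
    (D : set (g_sigma_algebraType (@open T))) : closed (D : set T) -> measurable D.
Proof.
move=> cD; rewrite -(setCK D); apply: measurableC.
by apply: sub_sigma_algebra; exact: closed_openC.
Qed.

Lemma continuous_borel_integrable (R : realType) (T : ptopologicalType)
    (mu : {measure set (g_sigma_algebraType (@open T)) -> \bar R})
    (D : set (g_sigma_algebraType (@open T))) (f : T -> R) (B : R) :
  measurable D -> (mu D < +oo)%E -> continuous f ->
  (forall x, D x -> `|f x| <= B) ->
  mu.-integrable D (fun x => (f x)%:E).
Proof.
move=> mD fD cf fB.
apply: (@measurable_bounded_integrable _ (g_sigma_algebraType (@open T)) R mu f
  D mD fD).
  exact: continuous_borel_measurable.
exists B; split=> [|M BM x Dx /=]; first exact: num_real.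
exact: le_trans (fB x Dx) (ltW BM).
Qed.

Lemma compact_continuous_bounded (R : realType) (T : topologicalType)
    (C : set T) (f : T -> R) : compact C -> continuous f ->
  exists2 B, 0 < B & forall x, C x -> `|f x| <= B.
Proof.
move=> cC cf.
have [M [_ hM]] := compact_bounded (continuous_compact (continuous_subspaceT cf) cC).
exists (`|M| + 1) => [|x Cx]; first by rewrite ltr_wpDl.
by apply: hM; [rewrite (le_lt_trans (ler_norm M))// ltrDl|exists x].
Qed.

End BorelIntegration.

Section PolynomialFunctions.
Variables (R : realType) (N : nat).

Definition mpoly_fun (h : {mpoly R[N]}) (x : 'rV[R]_N) : R :=
  h.@[fun i => x ord0 i].

Lemma mpoly_funX i : mpoly_fun 'X_i = fun x => x ord0 i.
Proof. by apply/funext => x; exact: mevalXU. Qed.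

Lemma mpoly_fun_continuous h : continuous (mpoly_fun h).
Proof.
pose V h := continuous (mpoly_fun h).
have VC c : V c%:MP.
  rewrite /V (_ : mpoly_fun _ = cst c); first exact: cst_continuous.
  by apply/funext => x; exact: mevalC.
have VD p q : V p -> V q -> V (p + q).
  move=> Vp Vq; rewrite /V (_ : mpoly_fun _ = mpoly_fun p \+ mpoly_fun q).
    by move=> x; apply: continuousD; [exact: Vp|exact: Vq].
  by apply/funext => x; exact: mevalD.
have VM p q : V p -> V q -> V (p * q).
  move=> Vp Vq; rewrite /V (_ : mpoly_fun _ = mpoly_fun p \* mpoly_fun q).
    by move=> x; apply: continuousM; [exact: Vp|exact: Vq].
  by apply/funext => x; exact: mevalM.
have VX i : V 'X_i by rewrite /V mpoly_funX; exact: coord_continuous.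
rewrite -/(V h) [h]mpolyE; apply: big_ind => [||a _] //.
  by rewrite -mpolyC0.
rewrite -mul_mpolyC; apply: (VM) => //; rewrite mpolyXE_id.
apply: big_ind => [||i _] //; first by rewrite -mpolyC1.
by elim: (a i) => [|k IH]; rewrite ?expr0 ?exprS -?mpolyC1//; exact: VM.
Qed.

Definition box (r : R) : set 'rV[R]_N := [set x | forall i, - r <= x ord0 i <= r].

Lemma box_compact r : compact (box r).
Proof.
rewrite (_ : box r = [set x | forall i, `[- r, r]%classic (x ord0 i)]).
  by apply: (@rV_compact R N (fun=> `[- r, r]%classic)) => _; exact: segment_compact.
by apply/seteqP; split=> x /= h i; have := h i; rewrite in_itv.
Qed.

Lemma box_closed r : closed (box r).
Proof. by apply: compact_closed; [exact: norm_hausdorff|exact: box_compact]. Qed.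

End PolynomialFunctions.

(** Compactness of a segment gives a cluster point, and along an ultrafilter a cluster point is a
    limit. Limits thus exist for all subsets at once. *)
Lemma ultra_bounded_cvg (R : realType) (I : Type) (U : set_system I)
    (UU : UltraFilter U) (u : I -> R) (a b : R) :
  (forall k, a <= u k <= b) -> exists l : R, u @ U --> l.
Proof.
move=> ab; have PU := @ultra_proper _ _ UU.
have [] := @segment_compact R a b (u @ U).
  by apply: nearW => k /=; rewrite in_itv /=.
move=> l [_ cl]; exists l => B lB.
have [//|UB] := in_ultra_setVsetC (u @^-1` B) UU.
have [y [By nBy]] := cl (~` B) B UB lB; by exfalso.
Qed.

(** The sum counts, with weight [e], the levels [k e] below [y]. The first clause is the saturated
    case, which the induction needs. *)
Lemma layer_cake (R : realType) (e y : R) n : 0 < e -> 0 <= y ->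
  (n%:R * e <= y -> \sum_(k < n) e * (k%:R * e < y)%R%:R = n%:R * e) /\
  (y < n%:R * e -> y <= \sum_(k < n) e * (k%:R * e < y)%R%:R <= y + e).
Proof.
move=> e0 y0; elim: n => [|n [IH1 IH2]].
  by rewrite big_ord0 mul0r; split=> // /(le_lt_trans y0); rewrite ltxx.
rewrite big_ord_recr /= -natr1 mulrDl mul1r.
have [yn|yn|yn] := ltgtP (n%:R * e) y.
- by rewrite mulr1 (IH1 (ltW yn)); split=> // yn1; apply/andP; split; lra.
- rewrite mulr0 addr0; split=> [|_]; last exact: IH2.
  by move=> h; lra.
- rewrite mulr0 addr0 IH1 ?yn//; split=> [h|_]; first by lra.
  by apply/andP; split; lra.
Qed.

Section Representation.
Variables (R : realType) (N : nat) (L : {scalar {mpoly R[N]}}) (rho r : R).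
Hypotheses (rho0 : 0 <= rho) (r0 : 0 < r) (rho_r : rho < r ^+ 2).
Hypothesis L_pos : box_pos L rho 1.

Local Notation borel := (g_sigma_algebraType (@open 'rV[R]_N)).
Local Notation bfun := (bern_fun L r).

Let L1 : 0 <= L 1.
Proof. by have := (L_pos 1).1; rewrite mul1r expr1n. Qed.

Let bfun_indic M (A : set 'rV[R]_N) : 0 <= bfun M \1_A <= L 1.
Proof.
rewrite -(bern_fun1 L r M); apply/andP; split.
  apply: sumr_ge0 => nu _; apply: mulr_ge0; first by rewrite indicE.
  exact: (bern_prod_ge0 rho0 r0 rho_r L_pos).
apply: (bern_fun_le rho0 r0 rho_r L_pos) => nu; rewrite indicE.
by case: (_ \in _).
Qed.

Lemma box_functional_repr :
  exists mu : {measure set borel -> \bar R},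
  [/\ mu setT = (L 1)%:E, mu (~` box r) = 0%E &
    forall h, (\int[mu]_(x in box r) (mpoly_fun h x)%:E)%E = (L h)%:E].
Proof.
have [U [UU ooU]] := ultraFilterLemma (@eventually_filter).
have PU := @ultra_proper _ _ UU.
(* The limiting mass of [A] under the discrete measures; using the same ultrafilter for all [A]
   makes these limits additive. *)
have /choice[nu nuP] : forall A : set 'rV[R]_N, exists l : R, bfun M \1_A @[M --> U] --> l.
  by move=> A; apply: ultra_bounded_cvg => M; exact: bfun_indic.
have nu_ge0 A : 0 <= nu A.
  by apply: (cvgr_to_ge (nuP A)); apply: nearW => M; case/andP: (bfun_indic M A).
have nuU A B : A `&` B = set0 -> nu (A `|` B) = nu A + nu B.
  move=> AB; apply: (cvg_unique _ (nuP _)) => /=; first exact: norm_hausdorff.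
  rewrite [X in X @ _ --> _](_ : _ = fun M => bfun M \1_A + bfun M \1_B).
    by apply: cvgD.
  apply/funext => M; rewrite -bern_funD; congr bern_fun.
  apply/funext => x; rewrite !indicE in_setU.
  case: (boolP (x \in A)) => [/set_mem Ax|_] /=; last by rewrite add0r.
  rewrite memNset ?addr0// => Bx.
  by have : (A `&` B) x by []; rewrite AB.
have nuT : nu setT = L 1.
  apply: (cvg_unique _ (nuP _)) => /=; first exact: norm_hausdorff.
  rewrite [X in X @ _ --> _](_ : _ = fun=> L 1); first exact: cvg_cst.
  by apply/funext => M; rewrite indicT bern_fun1.
have nuC : nu (~` box r) = 0.
  apply: (cvg_unique _ (nuP _)) => /=; first exact: norm_hausdorff.
  rewrite [X in X @ _ --> _](_ : _ = fun=> 0); first exact: cvg_cst.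
  apply/funext => M; rewrite /bern_fun big1// => al _.
  rewrite indicE memNset ?mul0r// => /(_ (bern_node_box r0 al)).
  by apply.
have nub : nu (box r) = L 1.
  by rewrite -nuT -(setUv (box r)) nuU ?nuC ?addr0// setICr.
have [mu [muU muC]] : exists mu : {measure set borel -> \bar R},
    (forall U : set 'rV[R]_N, open U -> mu U <= (nu U)%:E)%E /\
    (forall C : set 'rV[R]_N, compact C -> (nu C)%:E <= mu C)%E :=
  @open_regularization R 'rV[R]_N nu nu_ge0 nuU.
have mbox : measurable (box r : set borel).
  by apply: closed_borel_measurable; exact: box_closed.
have mub_ge : ((L 1)%:E <= mu (box r))%E.
  by rewrite -nub; apply: muC; exact: box_compact.
have muT : mu setT = (L 1)%:E.
  apply/eqP; rewrite eq_le; apply/andP; split.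
    by apply: le_trans (muU _ openT) _; rewrite nuT.
  apply: (le_trans mub_ge).
  by apply: le_measure; rewrite ?inE.
have mub : mu (box r) = (L 1)%:E.
  by apply/eqP; rewrite eq_le mub_ge andbT -muT le_measure ?inE.
have mubC : mu (~` box r) = 0%E.
  apply/eqP; rewrite eq_le measure_ge0 andbT.
  have := muU _ (closed_openC (@box_closed _ N r)).
  by rewrite nuC.
exists mu; split=> //.
have intb h : mu.-integrable (box r) (fun x => (mpoly_fun h x)%:E).
  have [B _ hB] := compact_continuous_bounded (@box_compact _ N r)
    (@mpoly_fun_continuous _ _ h).
  apply: (continuous_borel_integrable (B := B)) => //.
    by rewrite mub ltry.
  exact: mpoly_fun_continuous.
(* The upper bound at [- h] is the lower bound at [h]. *)
suff le h : (\int[mu]_(x in box r) (mpoly_fun h x)%:E <= (L h)%:E)%E.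
  move=> h; apply/eqP; rewrite eq_le le /=.
  have := le (- h); rewrite linearN /= EFinN.
  have -> : (\int[mu]_(x in box r) (mpoly_fun (- h) x)%:E =
             \int[mu]_(x in box r) ((-1)%:E * (mpoly_fun h x)%:E))%E.
    by apply: eq_integral => x _; rewrite -EFinM mulN1r; congr EFin; exact: mevalN.
  by rewrite integralZl// EFinN mulN1e leeN2.
have [B B0 hB] := compact_continuous_bounded (@box_compact _ N r)
  (@mpoly_fun_continuous _ _ h).
(* Adding the bound [B] makes the integrand nonnegative on the box, as the layer cake formula
   demands. *)
pose f := mpoly_fun (h + B%:MP).
have fE x : f x = mpoly_fun h x + B by rewrite /f /mpoly_fun mevalD mevalC.
have f01 x : box r x -> 0 <= f x <= 2 * B.
  by move=> /hB; rewrite fE ler_norml => /andP[]; lra.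
suff key e : 0 < e ->
    (\int[mu]_(x in box r) (f x)%:E <= (L (h + B%:MP) + e * L 1)%:E)%E.
  have {}key : (\int[mu]_(x in box r) (f x)%:E <= (L (h + B%:MP))%:E)%E.
    (* The divisor is [L 1 + 1] because [L 1] may vanish. *)
    apply/lee_addgt0Pr => e e0; have e'0 : 0 < e / (L 1 + 1).
      by rewrite divr_gt0// ltr_wpDl.
    apply: le_trans (key _ e'0) _; rewrite -EFinD lee_fin lerD2l.
    by rewrite mulrAC ler_pdivrMr ?ltr_wpDl// ler_wpM2l ?ltW// ltrDl.
  move: key; under eq_integral do rewrite fE EFinD.
  rewrite integralD//; last first.
    have := intb B%:MP; apply: eq_integrable => // x _; congr EFin.
    exact: mevalC.
  rewrite integral_cst// mub linearD /= -[B%:MP]mulr1 scalarMC.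
  by rewrite EFinD EFinM leeD2rE.
(* Strict superlevel sets are open, so [mu] is at most [nu] on them; the resulting sum is then
   compared with [f + e] under the discrete measures, before the limit. *)
move=> e0; pose O k := [set x : 'rV[R]_N | k%:R * e < f x].
have oO k : open (O k).
  have -> : O k = f @^-1` [set y | k%:R * e < y] by [].
  apply: open_comp; last exact: open_gt.
  by move=> x _; exact: mpoly_fun_continuous.
have indO k x : \1_(O k) x = (k%:R * e < f x)%R%:R :> R.
  rewrite indicE (_ : (x \in O k) = (k%:R * e < f x))//.
  by apply/idP/idP; rewrite inE.
near \oo => n.
have nB : 2 * B < n%:R * e.
  by rewrite -ltr_pdivrMr//; near: n; exact: nbhs_infty_gtr.
have cake x : box r x ->
    f x <= \sum_(k < n) e * \1_(O k) x <= f x + e.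
  move=> /f01/andP[f0 f1]; have [_] := layer_cake n e0 f0.
  under eq_bigr do rewrite -indO.
  by apply; exact: le_lt_trans nB.
have mO k : measurable (O k : set borel) by exact: sub_sigma_algebra.
apply: (@le_trans _ _ (\int[mu]_(x in box r) \sum_(k < n) (e * \1_(O k) x)%:E)%E).
  apply: ge0_le_integral => //.
  - by move=> x /f01/andP[]; rewrite lee_fin.
  - apply/measurable_EFinP; apply: continuous_borel_measurable => //.
    exact: mpoly_fun_continuous.
  - apply: emeasurable_sum => k; apply/measurable_EFinP.
    by apply: measurable_funM => //; exact: measurable_indic.
  - by move=> x /cake/andP[+ _]; rewrite sumEFin lee_fin.
rewrite ge0_integral_sum//; last 2 first.
- move=> k; apply/measurable_EFinP.
  by apply: measurable_funM => //; exact: measurable_indic.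
- move=> k x _; rewrite lee_fin; apply: mulr_ge0; first exact: ltW.
  by rewrite indicE.
apply: (@le_trans _ _ (\sum_(k < n) (e * nu (O k))%:E)%E).
  apply: lee_sum => k _; rewrite (integralZl_indic mbox (fun=> O k))//; last first.
    by move=> /(lt_trans e0); rewrite ltxx.
  rewrite integral_indic// EFinM; apply: lee_wpmul2l; first by rewrite lee_fin ltW.
  apply: le_trans (muU _ (oO k)); apply: le_measure; rewrite ?inE//.
  exact: measurableI.
rewrite sumEFin lee_fin.
have c1 : bfun M (fun x => \sum_(k < n) e * \1_(O k) x) @[M --> U] -->
    \sum_(k < n) e * nu (O k).
  rewrite [X in X @ _ --> _](_ : _ = fun M => \sum_(k < n) e * bfun M \1_(O k)).
    by apply: cvg_big => [|k _]; [exact: add_continuous|exact: cvgMr].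
  apply/funext => M; rewrite /bern_fun.
  under [RHS]eq_bigr do rewrite big_distrr.
  rewrite exchange_big /=; apply: eq_bigr => al _.
  by rewrite big_distrl; apply: eq_bigr => k _; rewrite /= mulrA.
have c2 : bfun M (fun x => f x + e * 1) @[M --> U] --> L (h + B%:MP) + e * L 1.
  rewrite [X in X @ _ --> _](_ : _ = fun M => bfun M f + e * L 1).
    apply: cvgD; last exact: cvg_cst.
    apply: cvg_trans; last exact: (bern_fun_poly rho0 r0 rho_r L_pos).
    by apply: cvg_app.
  by apply/funext => M; rewrite bern_funD bern_funZ bern_fun1.
apply: (ler_cvg_to c1 c2); apply: nearW => M.
apply: (bern_fun_le rho0 r0 rho_r L_pos) => al; rewrite mulr1.
by case/andP: (cake _ (bern_node_box r0 al)).
Unshelve. all: by end_near. Qed.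

End Representation.

(** * Riesz functionals and supports *)

Section RieszFunctional.
Variables (R : realType) (n m : nat).
Local Notation K := (n.+1 + m.+1)%N.
Implicit Types (z : 'X_{1..K} -> R) (g p q h : {mpoly R[K]}).

(** A summation range that does not depend on the support of [h] makes linearity visible. *)
Lemma ell_wide z k h : (msize h <= k)%N ->
  ell z h = \sum_(b : 'X_{1..K < k}) h@_b * z b.
Proof.
move=> hk; pose I : subFinType _ := 'X_{1..K < k}.
rewrite /ell (ssrcomplements.big_mksub I) ?msupp_uniq //=; first last.
  by move=> x /msize_mdeg_lt /leq_trans; apply.
by rewrite big_rmcond //= => b /memN_msupp_eq0 ->; rewrite mul0r.
Qed.

Lemma ell_is_linear z : scalar (ell z).
Proof.
move=> c p q; pose k := maxn (msize (c *: p + q)) (maxn (msize p) (msize q)).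
rewrite !(@ell_wide z k) ?leq_maxl//.
- rewrite big_distrr -big_split; apply: eq_bigr => b _ /=.
  by rewrite mcoeffD mcoeffZ; ring.
- by rewrite /k !leq_max leqnn !orbT.
- by rewrite /k !leq_max leqnn !orbT.
Qed.

HB.instance Definition _ z :=
  GRing.isLinear.Build R {mpoly R[K]} R *%R (ell z) (ell_is_linear z).

Lemma loc_psd_form e g z (xi : 'X_{1..K} -> R) :
  \sum_(a : 'X_{1..K < e}) \sum_(b : 'X_{1..K < e})
    xi a * xi b * ell z (g * 'X_[(a : 'X_{1..K}) + b]) =
  ell z (g * (\sum_(a : 'X_{1..K < e}) xi a *: 'X_[a]) ^+ 2).
Proof.
rewrite expr2 big_distrlr mulr_sumr linear_sum; apply: eq_bigr => a _ /=.
rewrite mulr_sumr linear_sum; apply: eq_bigr => b _ /=.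
have -> : g * (xi a *: 'X_[a] * (xi b *: 'X_[b])) =
    (xi a * xi b) *: (g * 'X_[(a : 'X_{1..K}) + b]).
  by rewrite mpolyXD -!mul_mpolyC mpolyCM; ring.
by rewrite linearZ_LR.
Qed.

(** A vector indexed by monomials of degree at most [e] is the coefficient family of a polynomial
    [p], and the quadratic form takes the value [ell z (g * p ^+ 2)] there. The bound is [e.+1]
    because [msize] is the degree plus one for nonzero polynomials. *)
Lemma loc_psdP e g z :
  loc_psd e g z <-> forall p, (msize p <= e.+1)%N -> 0 <= ell z (g * p ^+ 2).
Proof.
split=> [psd p pe|h xi].
  by have := psd (fun a => p@_a); 
    rewrite (loc_psd_form e.+1 g z (fun a => p@_a)) -(mpolywE pe).
rewrite loc_psd_form; apply: h.
apply: (leq_trans (msize_sum _ _ _)).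
apply/bigmax_leqP => a _; apply: leq_trans (msizeZ_le _ _) _.
by rewrite msizeX; exact: bmdeg.
Qed.

Lemma loc_psd_leq e e' g z : (e <= e')%N -> loc_psd e' g z -> loc_psd e g z.
Proof.
move=> ee' /loc_psdP h; apply/loc_psdP => p pe.
by apply: h; exact: leq_trans pe _.
Qed.

End RieszFunctional.

Section Support.
Variables (R : realType) (N : nat) (L : {scalar {mpoly R[N]}}) (r : R).
Local Notation borel := (g_sigma_algebraType (@open 'rV[R]_N)).
Variable mu : {measure set borel -> \bar R}.
Hypothesis mu_fin : (mu setT < +oo)%E.
Hypothesis mu_repr :
  forall h, (\int[mu]_(x in box r) (mpoly_fun h x)%:E)%E = (L h)%:E.

Lemma box_mass : mu (box r) = (L 1)%:E.
Proof.
have mbox : measurable (box r : set borel).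
  by apply: closed_borel_measurable; exact: box_closed.
rewrite -mu_repr (eq_integral (cst 1%E)); first by rewrite integral_cst// mul1e.
by move=> x _; rewrite /mpoly_fun meval1.
Qed.

(* Testing g >= 0 against the squares of (C - g)^k, which concentrate on {g < 0}. *)
Lemma null_negative_part g :
  (forall q, 0 <= L (g * q ^+ 2)) -> mu (box r `&` [set x | mpoly_fun g x < 0]) = 0%E.
Proof.
move=> gq.
have mbox : measurable (box r : set borel).
  by apply: closed_borel_measurable; exact: box_closed.
have cg := @mpoly_fun_continuous _ _ g.
have [C C0 gC] := compact_continuous_bounded (@box_compact _ N r) cg.
pose A e := box r `&` [set x | mpoly_fun g x <= - e].
have mA e : measurable (A e : set borel).
  apply: measurableI => //; apply: closed_borel_measurable.
  have -> : [set x | mpoly_fun g x <= - e] = mpoly_fun g @^-1` [set y | y <= - e] by [].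
  by apply: closed_comp => [x _|]; [exact: cg|exact: closed_le].
have A0 e : 0 < e -> mu (A e) = 0%E.
  move=> e0.
  have Afin : mu (A e) \is a fin_num.
    rewrite ge0_fin_numE//; apply: le_lt_trans mu_fin.
    by apply: le_measure; rewrite ?inE.
  suff : 0 <= - (e * fine (mu (A e))).
    rewrite oppr_ge0 pmulr_rle0// => le0; rewrite -[LHS]fineK//; congr EFin.
    by apply/eqP; rewrite eq_le le0 fine_ge0.
  have Ce0 : 0 < C + e by rewrite addr_gt0.
  have a1 : 0 <= (C / (C + e)) ^+ 2 < 1.
    rewrite sqr_ge0 /= expr_lt1// ?divr_ge0 ?(ltW C0) ?(ltW Ce0)//.
    by rewrite ltr_pdivrMr// mul1r ltrDl.
  apply: (ge0_geometric_bound (C := C * L 1) a1) => k.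
  rewrite lerN2 -exprM expr_div_n.
  set D := C ^+ _; set E := (C + e) ^+ _.
  have E0 : 0 < E by rewrite exprn_gt0.
  rewrite mulrAC ler_pdivlMr//.
  pose h := g * ((C%:MP - g) ^+ k) ^+ 2.
  have intA : mu.-integrable (box r) (fun x => (e * E * \1_(A e) x)%:E).
    apply: (@measurable_bounded_integrable _ borel R mu
      (fun x => e * E * \1_(A e) x) (box r) mbox).
    - by rewrite box_mass ltry.
    - by apply: measurable_funM => //; exact: measurable_indic.
    - exists (e * E); split=> [|M EM x _ /=]; first exact: num_real.
      apply: le_trans (ltW EM); rewrite indicE normrM.
      rewrite ger0_norm ?mulr_ge0 ?(ltW e0) ?(ltW E0)//.
      rewrite ler_piMr ?mulr_ge0 ?(ltW e0) ?(ltW E0)//.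
      by case: (_ \in _); rewrite ?normr1 ?normr0.
  have inth : mu.-integrable (box r) (fun x => (mpoly_fun h x)%:E).
    have [B _ hB] := compact_continuous_bounded (@box_compact _ N r)
      (@mpoly_fun_continuous _ _ h).
    apply: (continuous_borel_integrable (B := B)) => //.
      by rewrite box_mass ltry.
    exact: mpoly_fun_continuous.
  (* Where [g >= 0], the factor [(C - g)^(2k)] is at most [D = C^(2k)]; on [A e] it is at least
     [E = (C + e)^(2k)] while [g <= - e]. Integration gives [e E mu (A e) <= C D L 1], and [D / E]
     tends to 0 as [k] grows. *)
  have key x : box r x -> mpoly_fun h x + e * E * \1_(A e) x <= C * D.
    move=> bx; have gx := gC x bx.
    have -> : mpoly_fun h x = mpoly_fun g x * (C - mpoly_fun g x) ^+ (2 * k).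
      rewrite /mpoly_fun mevalM; congr (_ * _).
      by rewrite -exprM mulnC rmorphXn /= mevalB mevalC.
    set y := mpoly_fun g x in gx *.
    have [y0|y0] := leP 0 y.
      have -> : \1_(A e) x = 0 :> R.
        rewrite indicE memNset// => -[_]; rewrite /= -/y => ye.
        by have := le_trans y0 ye; rewrite oppr_ge0 leNgt e0.
      rewrite mulr0 addr0; move: gx; rewrite ger0_norm// => yC.
      apply: ler_pM => //; first by rewrite exprn_ge0// subr_ge0.
      by rewrite lerXn2r ?nnegrE ?subr_ge0 ?(ltW C0)// gerBl.
    have CD : 0 <= C * D by rewrite mulr_ge0 ?exprn_ge0 ?(ltW C0).
    have Cy : 0 <= C - y by rewrite subr_ge0 (le_trans (ltW y0) (ltW C0)).
    rewrite indicE; case: (boolP (x \in A e)) => [/set_mem[_ /= ye]|_].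
      rewrite mulr1; apply: le_trans CD; rewrite -/y in ye.
      rewrite -lerBrDr sub0r -mulNr.
      have EE : E <= (C - y) ^+ (2 * k).
        by rewrite lerXn2r ?nnegrE ?(ltW Ce0)// lerD2l lerNr.
      apply: (@le_trans _ _ (y * E)); last by rewrite ler_wpM2r ?(ltW E0).
      by apply: ler_wnM2l => //; exact: ltW.
    rewrite mulr0 addr0; apply: le_trans CD.
    by rewrite mulr_le0_ge0 ?(ltW y0)// exprn_ge0.
  have : (\int[mu]_(x in box r) ((mpoly_fun h x)%:E + (e * E * \1_(A e) x)%:E)
      <= \int[mu]_(x in box r) (cst (C * D)%:E x))%E.
    apply: le_integral => //; first exact: integrableD.
      apply: (continuous_borel_integrable (f := cst (C * D)) (B := `|C * D|)) => //.
        by rewrite box_mass ltry.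
      exact: cst_continuous.
    by move=> x /set_mem bx; rewrite -EFinD lee_fin; exact: key.
  rewrite integralD// mu_repr integral_cst// box_mass.
  have -> : (\int[mu]_(x in box r) (e * E * \1_(A e) x)%:E)%E =
      (e * E * fine (mu (A e)))%:E.
    rewrite (integralZl_indic mbox (fun=> A e))//; last first.
      by move=> /ltW; rewrite leNgt mulr_gt0.
    rewrite integral_indic// [RHS]EFinM fineK//; congr (_ * mu _)%E.
    by apply/setIidPl => x [].
  rewrite -EFinD -EFinM lee_fin => le1.
  have := gq ((C%:MP - g) ^+ k); rewrite -/h => h0.
  by lra.
have -> : box r `&` [set x | mpoly_fun g x < 0] = \bigcup_k A k.+1%:R^-1.
  apply/seteqP; split=> [x [bx /= gx]|x [k _ [bx /= gx]]]; last first.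
    by split=> //=; apply: le_lt_trans gx _; rewrite oppr_lt0.
  have gx' : 0 < - mpoly_fun g x by rewrite oppr_gt0.
  have [k _ kd] := near_infty_natSinv_lt (PosNum gx').
  exists k => //; split=> //=; rewrite lerNr ltW//.
  exact: (kd k (leqnn k)).
apply/eqP; rewrite eq_le measure_ge0 andbT.
apply: le_trans (measure_sigma_subadditive _ _ _ (@subset_refl _ _)) _ => //.
  exact: bigcupT_measurable.
by rewrite eseries0// => k _ _; exact: A0.
Qed.

End Support.

(** * Bernstein approximation of C1 functions *)

Section DeCasteljau.
Variable R : realType.
Implicit Types (w : nat -> R) (t : R).

(* [casteljau M w t] is the Bernstein sum of degree M with coefficients w,
   computed by de Casteljau's recursion. *)
Fixpoint casteljau (M : nat) w t : R :=
  if M is M'.+1 then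
    (1 - t) * casteljau M' w t + t * casteljau M' (fun k => w k.+1) t
  else w 0%N.

Lemma casteljauD M w w' t :
  casteljau M (fun k => w k + w' k) t = casteljau M w t + casteljau M w' t.
Proof. by elim: M w w' => //= M IH w w'; rewrite !IH; ring. Qed.

Lemma casteljauZ M c w t : casteljau M (fun k => c * w k) t = c * casteljau M w t.
Proof. by elim: M w => //= M IH w; rewrite !IH; ring. Qed.

Lemma casteljau_cst M c t : casteljau M (fun=> c) t = c.
Proof. by elim: M => //= M IH; rewrite !IH; ring. Qed.

Lemma casteljau_le M w w' t : 0 <= t <= 1 -> (forall k, (k <= M)%N -> w k <= w' k) ->
  casteljau M w t <= casteljau M w' t.
Proof.
move=> /andP[t0 t1]; elim: M w w' => [|M IH] w w' ww' /=; first exact: ww'.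
apply: lerD; apply: ler_wpM2l; rewrite ?subr_ge0//; apply: IH => k kM.
  by apply: ww'; exact: leqW.
exact: ww'.
Qed.

(** Second moment of the binomial law about [a]: variance [M t (1 - t)] plus the squared distance
    from the mean [M t] to [a]. *)
Lemma casteljau_sqr M a t :
  casteljau M (fun k => (k%:R - a) ^+ 2) t = M%:R * t * (1 - t) + (M%:R * t - a) ^+ 2.
Proof.
elim: M a => [|M IH] a /=; first by ring.
have -> : casteljau M (fun k => (k.+1%:R - a) ^+ 2) t =
          casteljau M (fun k => (k%:R - (a - 1)) ^+ 2) t.
  congr (casteljau _ _ t); apply/funext => k; rewrite -natr1; ring.
by rewrite !IH -natr1; ring.
Qed.

Lemma casteljau_near M w t y C (e d : R) :
  (0 < M)%N -> 0 <= t <= 1 -> 0 < d -> 0 <= C -> 0 <= e ->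
  (forall k, (k <= M)%N -> `|w k - y| <= C) ->
  (forall k, (k <= M)%N -> `|k%:R / M%:R - t| <= d -> `|w k - y| <= e) ->
  `|casteljau M w t - y| <= e + C / (d ^+ 2 * M%:R).
Proof.
move=> M0 t01 d0 C0 e0 wC we.
have MR : 0 < M%:R :> R by rewrite ltr0n.
(* A majorant of [|w k - y|]: the constant [e] serves the indices with [k / M] near [t], and the
   quadratic term exceeds [C] at the others, as in Chebyshev's inequality. Its Bernstein sum is
   known from [casteljau_sqr]. *)
pose b k : R := e + C / (d * M%:R) ^+ 2 * (k%:R - M%:R * t) ^+ 2.
have bE : casteljau M b t <= e + C / (d ^+ 2 * M%:R).
  rewrite casteljauD casteljau_cst casteljauZ casteljau_sqr lerD2l subrr expr0n addr0.
  have -> : C / (d * M%:R) ^+ 2 * (M%:R * t * (1 - t)) =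
      C / (d ^+ 2 * M%:R) * (t * (1 - t)).
    by field; rewrite gt_eqF//= gt_eqF.
  rewrite ler_piMr ?divr_ge0// ?mulr_ge0 ?sqr_ge0// ?ltW//.
  by case/andP: t01 => ? ?; nra.
have wb k : (k <= M)%N -> `|w k - y| <= b k.
  move=> kM; have [h|h] := leP `|k%:R / M%:R - t| d.
    apply: le_trans (we k kM h) _; rewrite /b lerDl mulr_ge0 ?sqr_ge0//.
    by rewrite divr_ge0// sqr_ge0.
  apply: le_trans (wC k kM) _.
  have -> : b k = e + C * ((k%:R / M%:R - t) / d) ^+ 2.
    by rewrite /b; field; rewrite gt_eqF//= gt_eqF.
  suff h1 : 1 <= ((k%:R / M%:R - t) / d) ^+ 2 by nra.
  rewrite -real_normK ?num_real// exprn_ege1// normrM normfV (gtr0_norm d0).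
  by rewrite ler_pdivlMr// mul1r ltW.
rewrite ler_norml; apply/andP; split.
  rewrite lerBrDr; apply: (@le_trans _ _ (- casteljau M b t + y)).
    by rewrite lerD2r lerN2.
  have -> : - casteljau M b t + y = casteljau M (fun k => - 1 * b k + y) t.
    rewrite (casteljauD M (fun k => -1 * b k) (fun=> y)).
    by rewrite casteljauZ casteljau_cst mulN1r.
  apply: casteljau_le => // k kM; have := wb k kM.
  by rewrite ler_norml => /andP[]; lra.
rewrite lerBlDr; apply: (@le_trans _ _ (casteljau M b t + y)); last first.
  by rewrite lerD2r.
have -> : casteljau M b t + y = casteljau M (fun k => b k + y) t.
  by rewrite (casteljauD M b (fun=> y)) casteljau_cst.
apply: casteljau_le => // k kM; have := wb k kM.
by rewrite ler_norml => /andP[]; lra.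
Qed.

(** The product rule applied to the recursion of [casteljau], for coefficients [w] with derivatives
    [w'] and a parameter [t] with derivative [dt]. *)
Fixpoint casteljau_diff (M : nat) w w' t dt : R :=
  if M is M'.+1 then
    - dt * casteljau M' w t + (1 - t) * casteljau_diff M' w w' t dt +
    (dt * casteljau M' (fun k => w k.+1) t +
     t * casteljau_diff M' (fun k => w k.+1) (fun k => w' k.+1) t dt)
  else w' 0%N.

(** The first term is the classical derivative of a Bernstein polynomial, a sum of forward
    differences of one degree less; the second differentiates the coefficients. *)
Lemma casteljau_diffE M w w' t dt : casteljau_diff M.+1 w w' t dt =
  dt * M.+1%:R * casteljau M (fun k => w k.+1 - w k) t + casteljau M.+1 w' t.
Proof.
have casteljauB m u u' : casteljau m (fun k => u k - u' k) t =
    casteljau m u t - casteljau m u' t.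
  elim: m u u' => //= m IH u u'; rewrite !IH; ring.
elim: M w w' => [|M IH] w w'; first by rewrite /= mulr1; ring.
have casteljauS m u : casteljau m.+1 u t =
  (1 - t) * casteljau m u t + t * casteljau m (fun k => u k.+1) t by [].
rewrite (_ : casteljau_diff M.+2 w w' t dt =
  - dt * casteljau M.+1 w t + (1 - t) * casteljau_diff M.+1 w w' t dt +
  (dt * casteljau M.+1 (fun k => w k.+1) t +
   t * casteljau_diff M.+1 (fun k => w k.+1) (fun k => w' k.+1) t dt))// !IH.
rewrite !casteljauS.
rewrite !casteljauB -[M.+2%:R]natr1; ring.
Qed.

End DeCasteljau.

(** The Heine-Cantor argument; only [x] is confined to [C], while [y] may leave it. *)
Lemma compact_uniformly_continuous (R : realType) (V : normedModType R)
    (C : set V) (g : V -> R) (e : R) : compact C -> continuous g -> 0 < e ->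
  exists2 d, 0 < d & forall x y, C x -> ball x d y -> `|g y - g x| <= e.
Proof.
move=> /compact_near_coveringP cC cg e0.
have e20 : 0 < e / 2 by rewrite divr_gt0.
have H : \forall d \near (0 : R)^'+,
    C `<=` (fun x => forall y, ball x d y -> `|g y - g x| <= e).
  apply: cC => x _.
  have /cvgrPdist_lt/(_ _ e20)/nbhs_ballP[eta /= eta0 h] := cg x.
  have eta20 : 0 < eta / 2 by rewrite divr_gt0.
  exists (ball x (eta / 2), [set d | d < eta / 2]) => /=.
    by split; [exact: nbhsx_ballx|exact: nbhs_right_lt].
  move=> [x' d] /= [xx' dlt] y x'y.
  have hx' : `|g x - g x'| < e / 2.
    apply: h; apply: le_ball xx'; by rewrite ler_pdivrMr// ler_peMr ?ler1n// ltW.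
  have hy : `|g x - g y| < e / 2.
    apply: h; rewrite (splitr eta); apply: ball_triangle xx' _.
    by apply: le_ball x'y; exact: ltW.
  have -> : g y - g x' = (g x - g x') - (g x - g y) by ring.
  by apply: le_trans (ler_normB _ _) _; lra.
near (0 : R)^'+ => d; exists d => [|x y Cx].
  by near: d; exact: nbhs_right_gt.
move: x Cx y; change (C `<=` (fun x => forall y, ball x d y -> `|g y - g x| <= e)).
by near: d.
Unshelve. all: by end_near. Qed.

Section CoordinateUpdate.
Variables (R : realType) (N : nat).
Implicit Types (x : 'rV[R]_N) (v : 'rV[R]_N -> R).

Definition upd x (i : 'I_N) (s : R) : 'rV[R]_N :=
  \row_j (if j == i then s else x ord0 j).

Lemma upd_self x i : upd x i (x ord0 i) = x.
Proof. by apply/rowP => j; rewrite !mxE; case: eqP => [->|]. Qed.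

Lemma upd_shift x i s h : upd x i (h + s) = h *: delta_mx ord0 i + upd x i s.
Proof.
apply/rowP => j; rewrite !mxE; case: eqP => _; first by rewrite eqxx mulr1.
by rewrite andbF mulr0 add0r.
Qed.

Lemma upd_shift_neq x i j s h : j != i ->
  upd (h *: delta_mx ord0 j + x) i s = h *: delta_mx ord0 j + upd x i s.
Proof.
move=> ji; apply/rowP => k; rewrite !mxE; case: (eqVneq k i) => [->|//].
by rewrite eqxx eq_sym (negbTE ji) mulr0 add0r.
Qed.

Lemma upd_shift_eq x i s h : upd (h *: delta_mx ord0 i + x) i s = upd x i s.
Proof.
apply/rowP => k; rewrite !mxE; case: (eqVneq k i) => [//|ki].
by rewrite mulr0 add0r.
Qed.

Lemma upd_box r x i s : box r x -> - r <= s <= r -> box r (upd x i s).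
Proof. by move=> bx sr j; rewrite mxE; case: eqP. Qed.

Lemma upd_ball x i s d : 0 < d -> `|s - x ord0 i| < d -> ball x d (upd x i s).
Proof.
move=> d0 sd; split=> // a j; rewrite (ord1 a) mxE.
case: eqP => [->|_]; last exact: ballxx.
by rewrite -ball_normE /ball_ /= distrC.
Qed.

Lemma upd_continuous i s : continuous (fun x => upd x i s).
Proof.
move=> x B /nbhs_ballP[e /= e0 hB]; apply/nbhs_ballP; exists e => //= y [_ h].
apply: hB; split=> // a j; rewrite !mxE.
by case: eqP => _; [exact: ballxx|exact: h].
Qed.

(** The partial derivatives are carried as an explicit family, so that each operation on [v] comes
    with formulas for them. *)
Definition is_C1 v (g : 'I_N -> 'rV[R]_N -> R) :=
  (forall i x, is_derive x (delta_mx ord0 i) v (g i x)) /\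
  (forall i, continuous (g i)).

Lemma is_derive_line v g x i s :
  is_C1 v g -> is_derive s (1 : R) (fun s => v (upd x i s)) (g i (upd x i s)).
Proof.
move=> [/(_ i (upd x i s)) [d1 d2] _].
have E : (fun h : R => h^-1 *: ((v \o shift (upd x i s)) (h *: delta_mx ord0 i)
    - v (upd x i s))) =
  (fun h : R => h^-1 *: (((fun s => v (upd x i s)) \o shift s) (h *: (1 : R))
    - v (upd x i s))).
  by apply/funext => h; rewrite /= /shift -upd_shift [h *: 1]mulr1.
by split; [move: d1; rewrite /derivable E|move: d2; rewrite /derive E].
Qed.

(** Freezing a coordinate at a node produces the coefficients of the Bernstein sum in that
    coordinate. *)
Lemma is_C1_upd v g i s : is_C1 v g ->
  is_C1 (fun x => v (upd x i s))
        (fun j x => if j == i then 0 else g j (upd x i s)).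
Proof.
move=> [dv cg]; split=> [j x|j]; last first.
  case: eqP => _; first exact: cst_continuous.
  move=> x; apply: (@continuous_comp _ _ _ (fun x => upd x i s) (g j)).
    exact: upd_continuous.
  exact: cg.
have [->|ji] := eqVneq j i.
  have E : (fun h : R => h^-1 *: (((fun x => v (upd x i s)) \o shift x)
      (h *: delta_mx ord0 i) - v (upd x i s))) = cst 0.
    apply/funext => h; rewrite /= /shift upd_shift_eq subrr scaler0 //.
  split; rewrite /derivable /derive E; first exact: is_cvg_cst.
  exact: lim_cst.
have [d1 d2] := dv j (upd x i s).
have E : (fun h : R => h^-1 *: ((v \o shift (upd x i s)) (h *: delta_mx ord0 j)
    - v (upd x i s))) =
  (fun h : R => h^-1 *: (((fun x => v (upd x i s)) \o shift x)
    (h *: delta_mx ord0 j) - v (upd x i s))).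
  by apply/funext => h; rewrite /= /shift upd_shift_neq.
by split; [move: d1; rewrite /derivable E|move: d2; rewrite /derive E].
Qed.

Lemma is_C1_MVT v g x i a b : is_C1 v g -> a <= b ->
  exists2 c, a <= c <= b &
    v (upd x i b) - v (upd x i a) = g i (upd x i c) * (b - a).
Proof.
move=> C1v ab.
have dv s := is_derive_line x i s C1v.
have [c|c cab E] := @MVT_segment R (fun s => v (upd x i s))
  (fun s => g i (upd x i s)) a b ab (fun s _ => dv s).
  apply: derivable_within_continuous => s _.
  by have [] := dv s.
by exists c => //; move: cab; rewrite in_itv.
Qed.

End CoordinateUpdate.

Section C1Approximation.
Variables (R : realType) (N : nat) (r : R).
Hypothesis r0 : 0 < r.
Implicit Types (v : 'rV[R]_N -> R) (g : 'I_N -> 'rV[R]_N -> R).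
Implicit Types (p q : {mpoly R[N]}) (x : 'rV[R]_N).

Definition C1_close v g v' g' (e : R) := forall x, box r x ->
  `|v x - v' x| <= e /\ forall i, `|g i x - g' i x| <= e.

Definition C1_approx v g := forall e, 0 < e ->
  exists q, C1_close v g (mpoly_fun q) (fun i => mpoly_fun (mderiv i q)) e.

Lemma C1_approx_lim v g :
  (forall e, 0 < e -> exists v' g', C1_close v g v' g' e /\ C1_approx v' g') ->
  C1_approx v g.
Proof.
move=> h e e0; have e20 : 0 < e / 2 by rewrite divr_gt0.
have [v' [g' [vv' /(_ _ e20)[q v'q]]]] := h _ e20.
exists q => x bx; have [h1 h2] := vv' x bx; have [h3 h4] := v'q x bx; split=> [|i].
  by apply: le_trans (ler_distD (v' x) _ _) _; rewrite (splitr e) lerD.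
by apply: le_trans (ler_distD (g' i x) _ _) _; rewrite (splitr e) lerD.
Qed.

Lemma C1_approxD v g v' g' : C1_approx v g -> C1_approx v' g' ->
  C1_approx (fun x => v x + v' x) (fun i x => g i x + g' i x).
Proof.
move=> Av Av' e e0; have e20 : 0 < e / 2 by rewrite divr_gt0.
have [q hq] := Av _ e20; have [q' hq'] := Av' _ e20.
exists (q + q') => x bx; have [h1 h2] := hq x bx; have [h3 h4] := hq' x bx.
split=> [|i]; rewrite ?mderivD /mpoly_fun mevalD opprD addrACA (splitr e);
  by apply: le_trans (ler_normD _ _) _; apply: lerD.
Qed.

Lemma C1_approxM p v g : C1_approx v g ->
  C1_approx (fun x => mpoly_fun p x * v x)
    (fun i x => mpoly_fun (mderiv i p) x * v x + mpoly_fun p x * g i x).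
Proof.
move=> Av e e0.
have [B B0 hB] := compact_continuous_bounded (@box_compact _ N r)
  (@mpoly_fun_continuous _ _ p).
have /choice[B' hB'] : forall i, exists b, 0 < b /\ forall x, box r x ->
    `|mpoly_fun (mderiv i p) x| <= b.
  move=> i; have [b b0 hb] := compact_continuous_bounded (@box_compact _ N r)
    (@mpoly_fun_continuous _ _ (mderiv i p)).
  by exists b.
(* One constant dominates the bound of [p] and, for each [i], that bound plus the bound of the
   partial derivative of [p]. *)
pose C := B + \sum_i B' i.
have B'0 i : 0 <= B' i by apply: ltW; have [] := hB' i.
have sB : 0 <= \sum_i B' i by apply: sumr_ge0 => i _.
have C0 : 0 < C by rewrite /C; lra.
have e20 : 0 < e / C by rewrite divr_gt0.
have [q hq] := Av _ e20; exists (p * q) => x bx; have [h1 h2] := hq x bx.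
have eE : e = C * (e / C) by rewrite mulrC divfK// gt_eqF.
split=> [|i].
  rewrite /mpoly_fun mevalM -mulrBr normrM.
  apply: le_trans (ler_pM _ _ (hB x bx) h1) _ => //.
  by rewrite [leRHS]eE ler_wpM2r ?(ltW e20)// /C lerDl.
rewrite mderivM /mpoly_fun mevalD !mevalM opprD addrACA -!mulrBr.
apply: le_trans (ler_normD _ _) _; rewrite !normrM.
apply: le_trans (lerD (ler_pM _ _ ((hB' i).2 x bx) h1)
  (ler_pM _ _ (hB x bx) (h2 i))) _ => //.
rewrite -mulrDl [leRHS]eE ler_wpM2r ?(ltW e20)// /C addrC lerD2l.
by rewrite (bigD1 i)//= lerDl sumr_ge0.
Qed.

Definition rescale_slope (i j : 'I_N) : R := if j == i then (2 * r)^-1 else 0.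

Definition rescale (i : 'I_N) (x : 'rV[R]_N) : R := (2 * r)^-1 * (r + x ord0 i).

Lemma unit_coord_fun i x : mpoly_fun (unit_coord r i) x = rescale i x.
Proof. by rewrite /mpoly_fun /unit_coord mevalM mevalD !mevalC mevalXU. Qed.

Lemma unit_coord_mderiv i j x : mpoly_fun (mderiv j (unit_coord r i)) x = rescale_slope i j.
Proof.
rewrite /unit_coord mderiv_mulC mderivD mderivC add0r mderivX mnm1E /rescale_slope eq_sym.
case: eqP => [->|_]; last by rewrite scale0r mulr0; exact: meval0.
rewrite scale1r (_ : (U_(i) - U_(i))%MM = 0%MM); last first.
  by apply/mnmP => k; rewrite mnmBE subnn mnm0E.
rewrite mpolyX0 mulr1.
exact: mevalC.
Qed.

(** Each level of the recursion multiplies by the polynomials [unit_coord] and [1 - unit_coord],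
    which preserves approximability by [C1_approxM]. A Bernstein sum is thereby reduced to its
    coefficients. *)
Lemma C1_approx_casteljau i M (v : nat -> 'rV[R]_N -> R)
    (g : nat -> 'I_N -> 'rV[R]_N -> R) :
  (forall k, C1_approx (v k) (g k)) ->
  C1_approx (fun x => casteljau M (fun k => v k x) (rescale i x))
    (fun j x => casteljau_diff M (fun k => v k x) (fun k => g k j x)
       (rescale i x) (rescale_slope i j)).
Proof.
elim: M v g => [|M IH] v g Av /=; first exact: Av.
have A1 := C1_approxM (1 - unit_coord r i) (IH _ _ Av).
have A2 := C1_approxM (unit_coord r i) (IH _ _ (fun k => Av k.+1)).
have := C1_approxD A1 A2; congr C1_approx.
  apply/funext => x; rewrite unit_coord_fun; congr (_ * _ + _).
  by rewrite /mpoly_fun mevalB meval1 -/(mpoly_fun _ x) unit_coord_fun.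
apply/funext => j; apply/funext => x; rewrite unit_coord_fun unit_coord_mderiv.
have -> : mpoly_fun (mderiv j (1 - unit_coord r i)) x = - rescale_slope i j.
  rewrite mderivB -mpolyC1 mderivC sub0r /mpoly_fun mevalN.
  by rewrite -/(mpoly_fun _ x) unit_coord_mderiv.
have -> : mpoly_fun (1 - unit_coord r i) x = 1 - rescale i x.
  by rewrite /mpoly_fun mevalB meval1 -/(mpoly_fun _ x) unit_coord_fun.
by [].
Qed.

Lemma rescale_itv x i : box r x -> 0 <= rescale i x <= 1.
Proof.
move=> /(_ i)/andP[h1 h2]; rewrite /rescale mulrC.
have r20 : 0 < 2 * r by rewrite mulr_gt0.
by rewrite divr_ge0 ?(ltW r20) ?ler_pdivrMr//=; lra.
Qed.

Lemma rescaleK x i : x ord0 i = 2 * r * rescale i x - r.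
Proof. by rewrite /rescale; field; rewrite gt_eqF. Qed.

Definition node (M k : nat) : R := 2 * r * (k%:R / M%:R) - r.

Lemma node_box M k : (k <= M)%N -> - r <= node M k <= r.
Proof.
move=> kM; rewrite /node.
have : 0 <= (k%:R / M%:R : R) <= 1.
  rewrite divr_ge0//=; case: M kM => [|M] kM; first by rewrite invr0 mulr0.
  by rewrite ler_pdivrMr// mul1r ler_nat.
move=> /andP[x0 x1]; set y := _ / _ in x0 x1 *.
have h0 : 0 <= r * y by rewrite mulr_ge0// ltW.
have h1 : r * y <= r by rewrite ler_piMr// ltW.
by apply/andP; split; lra.
Qed.

Lemma node_dist x i M k : `|node M k - x ord0 i| = 2 * r * `|k%:R / M%:R - rescale i x|.
Proof.
have -> : node M k - x ord0 i = 2 * r * (k%:R / M%:R - rescale i x).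
  by rewrite (rescaleK x i) /node; ring.
by rewrite normrM ger0_norm// mulr_ge0// ltW.
Qed.

(** The function and all its partial derivatives become Bernstein sums with coefficients close to
    the target: values of [v], values of [g j] at the nodes for [j] other than [i], and, by the mean
    value theorem, values of [g i] between adjacent nodes. *)
Lemma bernstein_C1_close v g i (e : R) : is_C1 v g -> 0 < e ->
  exists M : nat, C1_close v g
    (fun x => casteljau M (fun k => v (upd x i (node M k))) (rescale i x))
    (fun j x => casteljau_diff M (fun k => v (upd x i (node M k)))
       (fun k => if j == i then 0 else g j (upd x i (node M k)))
       (rescale i x) (rescale_slope i j))
    e.
Proof.
move=> C1v e0; have cg := C1v.2.
have e20 : 0 < e / 2 by rewrite divr_gt0.
have /choice[B hB] : forall j, exists b, 0 < b /\ forall x, box r x -> `|g j x| <= b.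
  move=> j; have [b b0 hb] := compact_continuous_bounded (@box_compact _ N r) (cg j).
  by exists b.
have /choice[D hD] : forall j, exists d, 0 < d /\
    forall x y, box r x -> ball x d y -> `|g j y - g j x| <= e / 2.
  move=> j; have [d d0 hd] := compact_uniformly_continuous (@box_compact _ N r) (cg j) e20.
  by exists d.
have B0 j : 0 < B j by have [] := hB j.
have D0 j : 0 < D j by have [] := hD j.
(* [d] lies below every modulus of continuity [D j], and [v], which is [B i]-Lipschitz along
   coordinate [i] in the box, varies by at most [e / 2] over a distance [d]. The witness is the
   inverse of a sum of reciprocals. *)
have [d d0 dD] : exists2 d, 0 < d & (forall j, d < D j) /\ d * B i <= e / 2.
  have Dj0 j : 0 <= (D j)^-1 by rewrite invr_ge0 ltW.
  have sD : 0 <= \sum_j (D j)^-1 by apply: sumr_ge0.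
  have Be : 0 < B i / (e / 2) by rewrite divr_gt0.
  pose S := \sum_j (D j)^-1 + B i / (e / 2).
  have S0 : 0 < S by rewrite ltr_wpDl.
  exists S^-1; first by rewrite invr_gt0.
  split=> [j|].
    rewrite -[ltRHS]invrK ltf_pV2 ?posrE ?invr_gt0// /S (bigD1 j)//= -addrA.
    by rewrite ltrDl ltr_wpDl// sumr_ge0.
  rewrite mulrC ler_pdivrMr// mulrC -ler_pdivrMr// /S.
  by rewrite lerDr.
have {dD}[dD dB] := dD.
pose C := 2 * (r * B i) + \sum_j 2 * B j.
have C0 : 0 <= C.
  by rewrite addr_ge0 ?mulr_ge0 ?(ltW r0) ?(ltW (B0 _))// sumr_ge0// => j _;
    rewrite mulr_ge0// ltW.
(* Since [2 r d' = d / 2], a distance [d'] in the unit interval becomes [d / 2] in the box; the rest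
   of [d] absorbs the gaps between nodes. *)
pose d' := d / (4 * r).
have d'0 : 0 < d' by rewrite divr_gt0// mulr_gt0.
near \oo => M.
have M0 : (0 < M)%N by near: M; exact: nbhs_infty_gt.
have MR : 0 < M%:R :> R by rewrite ltr0n.
have MC : C / (d' ^+ 2 * M%:R) <= e / 2.
  have p0 : 0 < d' ^+ 2 * (e / 2) by rewrite mulr_gt0// exprn_gt0.
  have : C / (d' ^+ 2 * (e / 2)) <= M%:R by near: M; exact: nbhs_infty_ger.
  have p1 : 0 < d' ^+ 2 * M%:R by rewrite mulr_gt0// exprn_gt0.
  by rewrite !ler_pdivrMr//; lra.
have Md : 4 * r / M%:R <= d / 2.
  have : 4 * r / (d / 2) <= M%:R by near: M; exact: nbhs_infty_ger.
  have d20 : 0 < d / 2 by rewrite divr_gt0.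
  by rewrite !ler_pdivrMr//; lra.
(* With degree [M.+1] the derivative along [i] is a sum of degree [M]; the estimate [conc] covers
   both degrees. *)
exists M.+1 => x bx.
have t01 := rescale_itv i bx.
have conc m w y c : (M <= m)%N -> c <= C -> 0 <= c ->
    (forall k, (k <= m)%N -> `|w k - y| <= c) ->
    (forall k, (k <= m)%N -> `|k%:R / m%:R - rescale i x| <= d' -> `|w k - y| <= e / 2) ->
    `|y - casteljau m w (rescale i x)| <= e.
  move=> Mm cC c0 wc we; rewrite distrC.
  have m0 : (0 < m)%N by exact: leq_trans Mm.
  apply: le_trans (casteljau_near m0 t01 d'0 c0 (ltW e20) wc we) _.
  rewrite [leRHS](splitr e) lerD2l; apply: le_trans MC.
  have mR : 0 < m%:R :> R by rewrite ltr0n.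
  apply: ler_pM => //; first by rewrite invr_ge0 mulr_ge0 ?sqr_ge0.
  have q0 : 0 < d' ^+ 2 by rewrite exprn_gt0.
  have p1 : 0 < d' ^+ 2 * m%:R by rewrite mulr_gt0.
  have p2 : 0 < d' ^+ 2 * M%:R by rewrite mulr_gt0.
  by rewrite lef_pV2// ler_pM2l// ler_nat.
have nodeb k : (k <= M.+1)%N -> box r (upd x i (node M.+1 k)).
  by move=> kM; apply: upd_box => //; exact: node_box.
have near_node k : `|k%:R / M.+1%:R - rescale i x| <= d' ->
    `|node M.+1 k - x ord0 i| <= d / 2.
  rewrite node_dist => h; apply: le_trans (ler_wpM2l _ h) _.
    by rewrite mulr_ge0// ltW.
  by rewrite /d' le_eqVlt; apply/orP; left; apply/eqP; field; rewrite gt_eqF.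
have gclose j s : `|s - x ord0 i| <= d -> `|g j (upd x i s) - g j x| <= e / 2.
  move=> h; apply: (hD j).2 => //; apply: upd_ball => //.
  exact: le_lt_trans h (dD j).
have gbound j y : box r y -> `|g j y - g j x| <= 2 * B j.
  move=> hy; apply: le_trans (ler_normB _ _) _.
  by have := (hB j).2 _ hy; have := (hB j).2 _ bx; lra.
have Bsum j : 2 * B j <= C.
  rewrite /C (bigD1 j)//= addrA addrAC lerDr addr_ge0//.
    by rewrite !mulr_ge0 ?(ltW r0) ?(ltW (B0 _)).
  by apply: sumr_ge0 => k _; rewrite mulr_ge0// ltW.
have lip s : - r <= s <= r -> `|v (upd x i s) - v x| <= B i * `|s - x ord0 i|.
  move=> sr; rewrite -{2}(upd_self x i).
  have xr := bx i.
  have [sx|/ltW xs] := leP s (x ord0 i).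
    have [c cr E] := is_C1_MVT x i C1v sx.
    rewrite distrC E normrM distrC ler_wpM2r//; apply: (hB i).2.
    by apply: upd_box => //; lra.
  have [c cr E] := is_C1_MVT x i C1v xs.
  rewrite E normrM ler_wpM2r//; apply: (hB i).2.
  by apply: upd_box => //; lra.
split=> [|j].
  apply: (conc _ _ _ (2 * (r * B i))); rewrite ?leqnSn//.
  - by rewrite /C lerDl sumr_ge0// => j _; rewrite mulr_ge0// ltW.
  - by rewrite !mulr_ge0 ?(ltW r0) ?(ltW (B0 _)).
  - move=> k kM; apply: le_trans (lip _ (node_box kM)) _.
    rewrite mulrA mulrC ler_wpM2r ?(ltW (B0 _))//.
    have := node_box kM; have := bx i.
    by move=> /andP[? ?] /andP[? ?]; rewrite ler_norml; apply/andP; split; lra.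
  - move=> k kM /near_node h; apply: le_trans (lip _ (node_box kM)) _.
    apply: le_trans dB; rewrite mulrC ler_wpM2r ?(ltW (B0 _))//.
    by apply: le_trans h _; lra.
rewrite casteljau_diffE /rescale_slope; have [->|ji] := eqVneq j i; last first.
  rewrite !mul0r add0r.
  apply: (conc _ _ _ (2 * B j)); rewrite ?leqnSn ?mulr_ge0 ?(ltW (B0 _))//.
    by move=> k kM; apply: gbound; exact: nodeb.
  by move=> k kM /near_node h; apply: gclose; apply: le_trans h _; lra.
rewrite casteljau_cst addr0 -casteljauZ.
have slope k : (k <= M)%N -> exists2 c, node M.+1 k <= c <= node M.+1 k.+1 &
    (2 * r)^-1 * M.+1%:R * (v (upd x i (node M.+1 k.+1)) - v (upd x i (node M.+1 k)))
    = g i (upd x i c).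
  move=> kM.
  have step : node M.+1 k.+1 - node M.+1 k = 2 * r / M.+1%:R.
    by rewrite /node -[k.+1%:R]natr1; ring.
  have [|c ck E] := @is_C1_MVT _ _ v g x i (node M.+1 k) (node M.+1 k.+1) C1v.
    by rewrite -subr_ge0 step divr_ge0// mulr_ge0// ltW.
  exists c => //; rewrite E step.
  transitivity ((2 * r)^-1 * (2 * r) * (M.+1%:R / M.+1%:R) * g i (upd x i c)).
    by ring.
  by rewrite mulVf ?divff ?mul1r ?pnatr_eq0// gt_eqF// mulr_gt0.
apply: (conc _ _ _ (2 * B i)); rewrite ?mulr_ge0 ?(ltW (B0 _))//.
  move=> k kM; have [c ck ->] := slope k kM; apply: gbound.
  apply: upd_box => //.
  have /andP[? ?] := node_box (leqW kM).
  by have /andP[? ?] := @node_box M.+1 k.+1 kM; case/andP: ck => ? ?; lra.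
move=> k kM h; have [c /andP[c1 c2] ->] := slope k kM; apply: gclose.
have M1 : 0 < M.+1%:R :> R by [].
(* In the sum of degree [M] the index [k] sits at [k / M], whereas [c] lies, after rescaling,
   between [k / (M + 1)] and [(k + 1) / (M + 1)]. Both ends are within [1 / M] of [k / M]. *)
have h1 : k%:R / M%:R - M%:R^-1 <= k%:R / M.+1%:R :> R.
  rewrite -subr_ge0 (_ : _ - _ = (M.+1%:R - k%:R) / (M%:R * M.+1%:R)).
    by rewrite divr_ge0 ?mulr_ge0// subr_ge0 ler_nat leqW.
  by rewrite -[M.+1%:R]natr1; field; rewrite natr1 !gt_eqF.
have h2 : k.+1%:R / M.+1%:R <= k%:R / M%:R + M%:R^-1 :> R.
  rewrite -subr_ge0 (_ : _ - _ = (k%:R + 1) / (M%:R * M.+1%:R)).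
    by rewrite divr_ge0 ?mulr_ge0// addr_ge0.
  by rewrite -[M.+1%:R]natr1 -[k.+1%:R]natr1; field; rewrite natr1 !gt_eqF.
have h3 : 2 * r * d' = d / 2 by rewrite /d'; field; rewrite gt_eqF.
have r20 : 0 < 2 * r by rewrite mulr_gt0.
rewrite (rescaleK x i) ler_norml; move: h; rewrite ler_norml => /andP[h4 h5].
have m1 := ler_wpM2l (ltW r20) h1; have m2 := ler_wpM2l (ltW r20) h2.
have m4 := ler_wpM2l (ltW r20) h4; have m5 := ler_wpM2l (ltW r20) h5.
rewrite !mulrDr ?mulrN in m1 m2 m4 m5; move: c1 c2; rewrite /node => c1 c2.
have Md' : 2 * r / M%:R <= d / 4 by lra.
clear - m1 m2 m4 m5 c1 c2 Md' h3 d0.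
move: m1 m2 m4 m5 c1 c2 Md' h3.
move: (2 * r * (k%:R / M.+1%:R)) (2 * r * (k.+1%:R / M.+1%:R))
  (2 * r * (k%:R / M%:R)) (2 * r / M%:R) (2 * r * rescale i x) (2 * r * d').
move=> a1 a2 a3 a4 a5 a6 m1 m2 m4 m5 c1 c2 Md' h3.
by apply/andP; split; lra.
Unshelve. all: by end_near. Qed.

(** Induction on a number [s] such that [v] depends only on its first [s] coordinates: the Bernstein
    sum in the last of these is close to [v], and its coefficients depend on one coordinate less. *)
Lemma is_C1_approx v g : is_C1 v g -> C1_approx v g.
Proof.
suff H s : forall v g, is_C1 v g ->
    (forall x y : 'rV[R]_N,
      (forall i : 'I_N, (i < s)%N -> x ord0 i = y ord0 i) -> v x = v y) ->
    C1_approx v g.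
  move=> C1v; apply: (H N) => // x y xy; congr v; apply/rowP => i.
  by apply: xy.
elim: s => [|s IH] {}v {}g C1v dep.
  move=> e e0; exists (v 0)%:MP => x bx.
  have vE : v = cst (v 0) by apply/funext => y; apply: dep.
  split=> [|i]; first by rewrite /mpoly_fun mevalC (dep x 0)// subrr normr0 ltW.
  have [d1 d2] := C1v.1 i x.
  rewrite mderivC /mpoly_fun meval0 -d2 {1}vE derive_cst subrr normr0 ltW//.
have [sN|Ns] := ltnP s N; last first.
  apply: IH => // x y xy; apply: dep => i _; apply: xy.
  exact: leq_trans Ns.
pose i0 := Ordinal sN.
apply: C1_approx_lim => e e0.
have [M cl] := bernstein_C1_close i0 C1v e0.
eexists; eexists; split; first exact: cl.
apply: (@C1_approx_casteljau i0 M (fun k x => v (upd x i0 (node M k)))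
  (fun k j x => if j == i0 then 0 else g j (upd x i0 (node M k)))) => k.
apply: IH; first exact: is_C1_upd.
move=> x y xy; apply: dep => i; rewrite ltnS leq_eqVlt !mxE => /orP[/eqP Ei|si].
  by rewrite (_ : i == i0)//; apply/eqP/val_inj.
by case: eqP => // _; exact: xy.
Qed.

End C1Approximation.

(** * The moment problem on a compact basic semialgebraic set *)

Section ArchimedeanMoment.
Variables (R : realType) (N : nat) (I : finType) (g : I -> {mpoly R[N]}).
Variables (i0 i1 : I) (rb : R).
Hypothesis g0 : g i0 = 1.
Hypothesis g1 : g i1 = rb%:MP - \sum_(j < N) 'X_j ^+ 2.

Local Notation borel := (g_sigma_algebraType (@open 'rV[R]_N)).

Definition basic_set : set 'rV[R]_N := [set x | forall i, 0 <= mpoly_fun (g i) x].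

(** The maximum keeps the bound nonnegative when [rb] is negative, and the square of [rho + 1]
    exceeds [rho]. *)
Let rho := Num.max rb 0.
Let r := rho + 1.

Let rho0 : 0 <= rho. Proof. by rewrite le_max lexx orbT. Qed.
Let r0 : 0 < r. Proof. by rewrite ltr_wpDl. Qed.
Let rho_r : rho < r ^+ 2. Proof. by rewrite /r; nra. Qed.

Let ball_term x : mpoly_fun (g i1) x = rb - \sum_(j < N) x ord0 j ^+ 2.
Proof.
rewrite g1 /mpoly_fun mevalB mevalC rmorph_sum; congr (_ - _).
by apply: eq_bigr => k _; rewrite rmorphXn /= mevalXU.
Qed.

Lemma basic_set_box : basic_set `<=` box r.
Proof.
move=> x Gx j; have := Gx i1; rewrite ball_term (bigD1 j)//=.
have : 0 <= \sum_(i < N | i != j) x ord0 i ^+ 2 by apply: sumr_ge0 => k _; exact: sqr_ge0.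
set S := \sum_(_ | _) _ => S0 h.
have h1 : x ord0 j ^+ 2 <= rho.
  by rewrite /rho le_max; apply/orP; left; lra.
rewrite -ler_norml -(@ler_pXn2r _ 2) ?nnegrE ?(ltW r0)//.
by rewrite real_normK ?num_real//; apply: le_trans h1 (ltW rho_r).
Qed.

Lemma basic_set_closed : closed basic_set.
Proof.
have -> : basic_set = \bigcap_(i in setT) (mpoly_fun (g i) @^-1` [set y | 0 <= y]).
  by apply/seteqP; split=> [x Gx i _|x Gx i]; [exact: Gx|exact: (Gx i)].
apply: closed_bigI => i _; apply: closed_comp; last exact: closed_ge.
by move=> x _; exact: mpoly_fun_continuous.
Qed.

Lemma basic_set_compact : compact basic_set.
Proof.
exact: subclosed_compact basic_set_closed (@box_compact _ N r) basic_set_box.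
Qed.

(** The ball constraint yields [box_pos], hence a representing measure on a box; positivity on [g i]
    times squares then removes all mass where some [g i] is negative. *)
Lemma archimedean_moment (L : {scalar {mpoly R[N]}}) :
  (forall i q, 0 <= L (g i * q ^+ 2)) ->
  exists mu : {measure set borel -> \bar R},
  [/\ (mu setT < +oo)%E, mu (~` basic_set) = 0%E &
    forall h, (\int[mu]_(x in basic_set) (mpoly_fun h x)%:E)%E = (L h)%:E].
Proof.
move=> Lg.
have sq s : 0 <= L (s ^+ 2) by have := Lg i0 s; rewrite g0 mul1r.
have L_pos : box_pos L rho 1.
  move=> s; split=> [|j]; rewrite mul1r; first exact: sq.
  (* [rho - X_j^2] is the nonnegative constant [rho - rb], plus the ball constraint, plus the
     squares of the other variables. *)
  have -> : (rho%:MP - 'X_j ^+ 2) * s ^+ 2 = (rho - rb)%:MP * s ^+ 2 +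
      (g i1 * s ^+ 2 + \sum_(i < N | i != j) ('X_i * s) ^+ 2).
    under eq_bigr do rewrite exprMn.
    by rewrite -mulr_suml g1 (bigD1 j)//= mpolyCB; ring.
  rewrite linearD scalarMC; apply: addr_ge0.
    by apply: mulr_ge0 => //; rewrite subr_ge0 /rho le_max lexx.
  rewrite linearD; apply: addr_ge0; first exact: Lg.
  by rewrite linear_sum; apply: sumr_ge0 => i _; exact: sq.
have [mu [muT mubC repr]] := box_functional_repr rho0 r0 rho_r L_pos.
have mbox : measurable (box r : set borel).
  by apply: closed_borel_measurable; exact: box_closed.
have mG : measurable (basic_set : set borel).
  by apply: closed_borel_measurable; exact: basic_set_closed.
have fT : (mu setT < +oo)%E by rewrite muT ltry.
have muGC : mu (~` basic_set) = 0%E.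
  pose A i : set borel := box r `&` [set x | mpoly_fun (g i) x < 0].
  have A0 i : mu (A i) = 0%E by exact: (null_negative_part fT repr (Lg i)).
  have mA i : measurable (A i).
    apply: measurableI => //; apply: sub_sigma_algebra.
    have -> : [set x | mpoly_fun (g i) x < 0] = mpoly_fun (g i) @^-1` [set y | y < 0] by [].
    apply: open_comp; last exact: open_lt.
    by move=> x _; exact: mpoly_fun_continuous.
  have mU (s : seq I) : measurable (\big[setU/set0]_(i <- s) A i).
    by apply: bigsetU_measurable => i _; exact: mA.
  have U0 (s : seq I) : mu (\big[setU/set0]_(i <- s) A i) = 0%E.
    elim: s => [|i s IH]; first by rewrite big_nil measure0.
    rewrite big_cons; apply/eqP; rewrite eq_le measure_ge0 andbT.
    have : (mu (A i `|` \big[setU/set0]_(i <- s) A i) <=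
      mu (A i) + mu (\big[setU/set0]_(i <- s) A i))%E := measureU2 _ (mA i) (mU s).
    by rewrite IH A0 adde0.
  have sub : ~` basic_set `<=` ~` box r `|` \big[setU/set0]_(i <- enum I) A i.
    move=> x nGx; have [bx|] := pselect (box r x); last by left.
    right; rewrite -bigcup_seq.
    have [i gi] : exists i, ~ (0 <= mpoly_fun (g i) x) by exact/existsNP.
    exists i; first by rewrite /= mem_enum.
    by split=> //=; rewrite ltNge; exact/negP.
  apply/eqP; rewrite eq_le measure_ge0 andbT.
  apply: (@le_trans _ _ (mu (~` box r `|` \big[setU/set0]_(i <- enum I) A i))).
    by apply: le_measure => //; rewrite inE; [exact: measurableC|
      apply: measurableU => //; exact: measurableC].
  have : (mu (~` box r `|` \big[setU/set0]_(i <- enum I) A i) <=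
      mu (~` box r) + mu (\big[setU/set0]_(i <- enum I) A i))%E.
    exact: measureU2 (measurableC mbox) (mU _).
  by rewrite mubC U0 adde0.
exists mu; split=> // h; rewrite -repr.
have [B _ hB] := compact_continuous_bounded (@box_compact _ N r)
  (@mpoly_fun_continuous _ _ h).
have inth : mu.-integrable (box r) (fun x => (mpoly_fun h x)%:E).
  apply: (continuous_borel_integrable (B := B)) => //.
    apply: le_lt_trans fT; apply: le_measure; rewrite ?inE//.
  exact: mpoly_fun_continuous.
rewrite (negligible_integral (measurableC mG) mbox inth muGC); congr integral.
apply/seteqP; split=> x; first by move=> Gx; split; [exact: basic_set_box|apply].
by move=> [_ /contrapT].
Qed.

End ArchimedeanMoment.

(** * Polynomials as C1 functions *)

Section PolynomialC1.
Variables (R : realType) (N : nat).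

Lemma mpoly_fun_is_C1 (q : {mpoly R[N]}) :
  is_C1 (mpoly_fun q) (fun i => mpoly_fun (mderiv i q)).
Proof.
split=> [i x|i]; last exact: mpoly_fun_continuous.
pose V q := is_derive x (delta_mx ord0 i) (mpoly_fun q) (mpoly_fun (mderiv i q) x).
have VC c : V c%:MP.
  rewrite /V mderivC /mpoly_fun meval0.
  rewrite (_ : (fun x => _) = cst c); first exact: is_derive_cst.
  by apply/funext => y; exact: mevalC.
have VD p p' : V p -> V p' -> V (p + p').
  move=> Vp Vp'; have := is_deriveD Vp Vp'; rewrite /V mderivD.
  rewrite (_ : mpoly_fun p + mpoly_fun p' = mpoly_fun (p + p')).
    by move=> h; apply: is_derive_eq h _; rewrite [RHS]/mpoly_fun mevalD.
  by apply/funext => y; rewrite [RHS]/mpoly_fun mevalD.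
have VM p p' : V p -> V p' -> V (p * p').
  move=> Vp Vp'; have := is_deriveM Vp Vp'; rewrite /V mderivM.
  rewrite (_ : mpoly_fun p * mpoly_fun p' = mpoly_fun (p * p')).
    move=> h; apply: is_derive_eq h _.
    by rewrite [in RHS]/mpoly_fun mevalD !mevalM /mpoly_fun /GRing.scale /=; ring.
  by apply/funext => y; rewrite [RHS]/mpoly_fun mevalM.
have VX j : V 'X_j.
  rewrite /V mpoly_funX mderivX.
  have c : (fun h : R => h^-1 *: (((fun x : 'rV[R]_N => x ord0 j) \o shift x)
      (h *: delta_mx ord0 i) - x ord0 j)) @ 0^' --> ((j == i)%:R : R).
    apply: cvg_near_cst; near=> h.
    have h0 : h != 0 by near: h; exact: nbhs_dnbhs_neq.
    by rewrite /= /shift !mxE eqxx /= addrK /GRing.scale /= mulKf.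
  have -> : mpoly_fun ((U_(j)%MM i)%:R *: 'X_[(U_(j) - U_(i))]) x = (j == i)%:R.
    rewrite /mpoly_fun mevalZ mnm1E; case: eqP => [->|_]; last by rewrite mul0r.
    rewrite (_ : (U_(i) - U_(i))%MM = 0%MM) ?mpolyX0 ?meval1 ?mulr1//.
    by apply/mnmP => k; rewrite mnmBE subnn mnm0E.
  split; first by apply/cvg_ex; exists (j == i)%:R.
  exact: cvg_lim.
rewrite -/(V q) [q]mpolyE; apply: big_ind => [||a _] //.
  by rewrite -mpolyC0.
rewrite -mul_mpolyC; apply: (VM) => //; rewrite mpolyXE_id.
apply: big_ind => [||j _] //; first by rewrite -mpolyC1.
by elim: (a j) => [|k IH]; rewrite ?expr0 ?exprS -?mpolyC1//; exact: VM.
Unshelve. all: by end_near. Qed.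

End PolynomialC1.

(** * The transport constraint *)

Section IntegralComparison.
Variables (R : realType) (d : measure_display) (T : measurableType d).
Variables (mu : {measure set T -> \bar R}) (D : set T).
Hypotheses (mD : measurable D) (fD : (mu D < +oo)%E).

Lemma fine_integral_le (f g : T -> R) (c : R) :
  mu.-integrable D (fun x => (f x)%:E) -> mu.-integrable D (fun x => (g x)%:E) ->
  (forall x, D x -> f x <= g x + c) ->
  fine (\int[mu]_(x in D) (f x)%:E)%E <=
  fine (\int[mu]_(x in D) (g x)%:E)%E + c * fine (mu D).
Proof.
move=> intf intg fg.
have intc : mu.-integrable D (cst c%:E).
  apply: (@measurable_bounded_integrable _ T R mu (cst c) D mD fD) => //.
  by exists `|c|; split=> [|M cM x _]; [exact: num_real|exact: ltW].
have If := integrable_fin_num mD intf; have Ig := integrable_fin_num mD intg.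
have muD : mu D \is a fin_num by rewrite ge0_fin_numE.
have : (\int[mu]_(x in D) (f x)%:E <= \int[mu]_(x in D) ((g x)%:E + cst c%:E x))%E.
  apply: le_integral => //; first exact: integrableD.
  by move=> x /set_mem Dx; rewrite -EFinD lee_fin; exact: fg.
rewrite integralD// integral_cst//.
by rewrite -(fineK If) -(fineK Ig) -(fineK muD) -EFinM -EFinD lee_fin.
Qed.

Lemma fine_integral_dist (f g : T -> R) (c : R) :
  mu.-integrable D (fun x => (f x)%:E) -> mu.-integrable D (fun x => (g x)%:E) ->
  (forall x, D x -> `|f x - g x| <= c) ->
  `|fine (\int[mu]_(x in D) (f x)%:E)%E - fine (\int[mu]_(x in D) (g x)%:E)%E|
    <= c * fine (mu D).
Proof.
move=> intf intg fg.
have h1 : fine (\int[mu]_(x in D) (f x)%:E)%E <=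
    fine (\int[mu]_(x in D) (g x)%:E)%E + c * fine (mu D).
  apply: fine_integral_le => // x /fg; rewrite ler_norml => /andP[]; lra.
have h2 : fine (\int[mu]_(x in D) (g x)%:E)%E <=
    fine (\int[mu]_(x in D) (f x)%:E)%E + c * fine (mu D).
  apply: fine_integral_le => // x /fg; rewrite ler_norml => /andP[]; lra.
by rewrite ler_norml; apply/andP; split; lra.
Qed.

End IntegralComparison.

Section WeakConstraint.
Variables (R : realType) (n m : nat) (p : nat).
Local Notation K := (n.+1 + m.+1)%N.
Variable fh : 'I_n -> {mpoly R[K]}.

(** The linear extension of [Lpoly] from monomials to all polynomials in [(t, y)]; through it the
    moment equations become the weak constraint for polynomial test functions. *)
Definition transport_poly (q : {mpoly R[n.+1]}) : {mpoly R[K]} :=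
  \sum_(a <- msupp q) q@_a *: Lpoly p fh a.

(** [vmon] pads a multi-index with zero exponents, so the variables [w0] and [w] contribute only
    factors equal to 1. *)
Lemma mderiv_vmon (i : 'I_n.+1) a (x : 'rV[R]_K) :
  mpoly_fun (mderiv (lshift m.+1 i) 'X_[vmon m a]) x =
  mpoly_fun (mderiv i 'X_[a]) (typart x).
Proof.
rewrite !mderivX /mpoly_fun !mevalZ !mevalX big_split_ord /=.
have vE j : vmon m a (lshift m.+1 j) = a j.
  rewrite mnmE; case: splitP => k /= E; first by congr (a _); apply/val_inj.
  by have := ltn_ord j; rewrite E ltnNge leq_addr.
have wE j : x ord0 (rshift n.+1 j) ^+
    (vmon m a - U_(lshift m.+1 i))%MM (rshift n.+1 j) = 1.
  rewrite mnmBE mnm1E mnmE.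
  case: splitP => [k /= E|k _]; last by rewrite sub0n expr0.
  by have := ltn_ord k; rewrite -E /= ltnNge leq_addr.
rewrite vE (eq_bigr _ (fun j _ => wE j)) big1_eq mulr1.
congr (_ * _); apply: eq_bigr => j _; rewrite !mnmBE vE !mnm1E mxE.
by congr (_ ^+ (_ - _)); rewrite (inj_eq (@lshift_inj _ _)).
Qed.

Lemma mderiv_fun_sum (q : {mpoly R[n.+1]}) i y :
  mpoly_fun (mderiv i q) y =
  \sum_(a <- msupp q) q@_a * mpoly_fun (mderiv i 'X_[a]) y.
Proof.
rewrite {1}[q]mpolyE linear_sum /mpoly_fun rmorph_sum; apply: eq_bigr => a _.
by rewrite /= mderivZ mevalZ.
Qed.

Lemma transport_polyE q x : mpoly_fun (transport_poly q) x =
  mpoly_fun (mderiv ord0 q) (typart x) * x ord0 (iw0 n m) ^+ p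
  + \sum_(j < n) mpoly_fun (mderiv (lift ord0 j) q) (typart x) * evalK (fh j) x.
Proof.
rewrite mderiv_fun_sum mulr_suml.
under [X in _ = _ + X]eq_bigr do rewrite mderiv_fun_sum mulr_suml.
rewrite exchange_big -big_split /transport_poly /mpoly_fun rmorph_sum /=.
apply: eq_bigr => a _; rewrite mevalZ mevalD mevalM rmorphXn /= mevalXU.
have E0 : ('X_[vmon m a]^`M(it n m)).@[fun i => x ord0 i] =
    ('X_[a]^`M(ord0)).@[fun i => typart x ord0 i] := mderiv_vmon ord0 a x.
have Ej j : ('X_[vmon m a]^`M(iy m j)).@[fun i => x ord0 i] =
    ('X_[a]^`M(lift ord0 j)).@[fun i => typart x ord0 i].
  exact: (mderiv_vmon (lift ord0 j) a x).
rewrite E0 mulrDr mulrA; congr (_ + _).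
rewrite [(\sum_(j < n) _).@[_]]rmorph_sum /= mulr_sumr; apply: eq_bigr => j _.
by rewrite mevalM Ej mulrA.
Qed.

Lemma C1_is_C1 (v : 'rV[R]_n.+1 -> R) :
  C1 v -> is_C1 v (fun i => 'D_(delta_mx ord0 i) v).
Proof.
by move=> h; split=> i; [move=> x; apply: derivableP; exact: (h i).1|exact: (h i).2].
Qed.

Lemma mpoly_fun_C1 (q : {mpoly R[n.+1]}) : C1 (mpoly_fun q).
Proof.
have [h1 h2] := mpoly_fun_is_C1 q; move=> i; split=> [x|].
  by have [] := h1 i x.
rewrite (_ : 'D__ _ = mpoly_fun (mderiv i q)); first exact: h2.
by apply/funext => x; have [] := h1 i x.
Qed.

Lemma weak_constraint_poly q x :
  weak_constraint p fh (mpoly_fun q) x = mpoly_fun (transport_poly q) x.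
Proof.
have [h1 _] := mpoly_fun_is_C1 q.
have dE i y : 'D_(delta_mx ord0 i) (mpoly_fun q) y = mpoly_fun (mderiv i q) y.
  by have [] := h1 i y.
rewrite transport_polyE /weak_constraint dE; congr (_ + _).
by apply: eq_bigr => j _; rewrite dE.
Qed.

Lemma typart_continuous : continuous (@typart R n m).
Proof.
move=> x B /nbhs_ballP[e /= e0 hB]; apply/nbhs_ballP; exists e => //= y [_ h].
by apply: hB; split=> // a j; rewrite !mxE; exact: h.
Qed.

Lemma weak_constraint_continuous v : C1 v -> continuous (weak_constraint p fh v).
Proof.
move=> /C1_is_C1[_ cv].
have c1 i : continuous (fun x : 'rV[R]_K => 'D_(delta_mx ord0 i) v (typart x)).
  move=> x; apply: (@continuous_comp _ _ _ (@typart R n m)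
    ('D_(delta_mx ord0 i) v : 'rV[R]_n.+1 -> R)).
    exact: typart_continuous.
  exact: cv.
have c2 j : continuous (fun x : 'rV[R]_K => evalK (fh j) x).
  exact: mpoly_fun_continuous.
have c3 : continuous (fun x : 'rV[R]_K => x ord0 (iw0 n m) ^+ p).
  rewrite (_ : (fun x => _) = mpoly_fun ('X_(iw0 n m) ^+ p)).
    exact: mpoly_fun_continuous.
  by apply/funext => x; rewrite /mpoly_fun rmorphXn /= mevalXU.
pose F (j : 'I_n) (x : 'rV[R]_K) :=
  'D_(delta_mx ord0 (lift ord0 j)) v (typart x) * evalK (fh j) x.
have cS (s : seq 'I_n) : continuous (fun x => \sum_(j <- s) F j x).
  elim: s => [|j s IH].
    rewrite (_ : (fun x => _) = cst 0); first exact: cst_continuous.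
    by apply/funext => x; rewrite big_nil.
  rewrite (_ : (fun x => _) = F j \+ (fun x => \sum_(j <- s) F j x)).
    move=> x; apply: continuousD; last exact: IH.
    by apply: continuousM; [exact: c1|exact: c2].
  by apply/funext => x; rewrite big_cons.
move=> x; apply: (@continuousD _ _ _
  (fun x => 'D_(delta_mx ord0 ord0) v (typart x) * x ord0 (iw0 n m) ^+ p)).
  by apply: continuousM; [exact: c1|exact: c3].
exact: cS.
Qed.

(** Both sides are continuous for the C1 norm on a box containing [P], [Q] and the projection of
    [G], and polynomials are dense there by [is_C1_approx]. *)
Lemma weak_constraint_density (G : set 'rV[R]_K) (P Q : 'rV[R]_n.+1)
    (mu : {measure set (BorelK R n m) -> \bar R}) :
  compact G -> (mu setT < +oo)%E ->
  (forall q, (\int[mu]_(x in G) (mpoly_fun (transport_poly q) x)%:E)%E =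
    (mpoly_fun q P - mpoly_fun q Q)%:E) ->
  forall v, C1 v ->
    (\int[mu]_(x in G) (weak_constraint p fh v x)%:E)%E = (v P - v Q)%:E.
Proof.
move=> cG muT polyE v C1v.
have mG : measurable (G : set (BorelK R n m)).
  by apply: closed_borel_measurable; apply: compact_closed => //; exact: norm_hausdorff.
have muG : (mu G < +oo)%E.
  by apply: le_lt_trans muT; apply: le_measure; rewrite ?inE.
have intc (f : 'rV[R]_K -> R) : continuous f -> mu.-integrable G (fun x => (f x)%:E).
  move=> cf; have [B _ hB] := compact_continuous_bounded cG cf.
  exact: (continuous_borel_integrable (B := B)).
have [rho rho0 hrho] : exists2 rho, 0 < rho &
    [/\ box rho P, box rho Q & forall x, G x -> box rho (typart x)].
  have /choice[b hb] : forall i : 'I_n.+1, exists b, 0 <= b /\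
      forall x, G x -> `|x ord0 (lshift m.+1 i)| <= b.
    move=> i; have [b b0 hb] := compact_continuous_bounded cG
      (@mpoly_fun_continuous _ _ ('X_(lshift m.+1 i) : {mpoly R[K]})).
    by rewrite mpoly_funX in hb; exists b; split=> //; exact: ltW.
  pose c i := b i + `|P ord0 i| + `|Q ord0 i|.
  have c0 i : 0 <= c i by rewrite !addr_ge0// (hb i).1.
  have cs i : c i <= 1 + \sum_j c j.
    by rewrite (bigD1 i)//= addrCA lerDl addr_ge0// sumr_ge0.
  exists (1 + \sum_i c i); first by rewrite ltr_pwDl// sumr_ge0.
  split=> [i|i|x Gx i]; rewrite -ler_norml; apply: le_trans (cs i); rewrite /c.
  - by rewrite -addrA addrCA lerDl addr_ge0// (hb i).1.
  - by rewrite lerDr addr_ge0// (hb i).1.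
  - by rewrite mxE -addrA; apply: le_trans ((hb i).2 x Gx) _; rewrite lerDl addr_ge0.
have [bP bQ bG] := hrho.
have /choice[B hB] : forall j, exists b, 0 <= b /\ forall x, G x -> `|evalK (fh j) x| <= b.
  move=> j; have [b b0 hb] := compact_continuous_bounded cG
    (@mpoly_fun_continuous _ _ (fh j)).
  by exists b; split=> //; exact: ltW.
have [B0 B00 hB0] := compact_continuous_bounded cG
  (@mpoly_fun_continuous _ _ ('X_(iw0 n m) ^+ p : {mpoly R[K]})).
pose S := B0 + \sum_j B j.
have B'0 j : 0 <= B j by have [] := hB j.
have S0 : 0 <= S by rewrite addr_ge0 ?(ltW B00)// sumr_ge0.
have Ifin := integrable_fin_num mG (intc _ (weak_constraint_continuous C1v)).
set I := fine (\int[mu]_(x in G) (weak_constraint p fh v x)%:E)%E.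
suff E : I = v P - v Q by rewrite -E /I fineK.
(* With accuracy [e / C], the integral contributes the share [S * fine (mu G)] of the error and the
   values at [P] and [Q] one unit each. *)
pose C := S * fine (mu G) + 2.
have C0 : 0 < C.
  by rewrite ltr_wpDl// mulr_ge0// fine_ge0.
apply/eqP; rewrite -subr_eq0 -normr_le0; apply/ler_addgt0Pr => e e0; rewrite add0r.
have e'0 : 0 < e / C by rewrite divr_gt0.
have [q hq] := is_C1_approx rho0 (C1_is_C1 C1v) e'0.
have d1 : `|I - (mpoly_fun q P - mpoly_fun q Q)| <= e / C * S * fine (mu G).
  rewrite -[mpoly_fun q P - _]/(fine (mpoly_fun q P - mpoly_fun q Q)%:E) -polyE.
  apply: fine_integral_dist => //.
  - by apply: intc; exact: weak_constraint_continuous.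
  - by apply: intc; exact: mpoly_fun_continuous.
  move=> x Gx; rewrite transport_polyE /weak_constraint.
  have [_ hi] := hq _ (bG _ Gx).
  rewrite opprD addrACA -mulrBl -sumrB.
  apply: le_trans (ler_normD _ _) _; rewrite /S mulrDr normrM; apply: lerD.
    apply: ler_pM => //.
    by have := hB0 x Gx; rewrite /mpoly_fun rmorphXn /= mevalXU.
  apply: le_trans (ler_norm_sum _ _ _) _; rewrite mulr_sumr; apply: ler_sum => j _.
  by rewrite -mulrBl normrM; apply: ler_pM => //; exact: (hB j).2.
have [d2 _] := hq P bP; have [d3 _] := hq Q bQ.
have eC : e = e / C * S * fine (mu G) + e / C + e / C.
  have -> : e / C * S * fine (mu G) + e / C + e / C = e / C * C by rewrite /C; ring.
  by rewrite divfK// gt_eqF.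
rewrite eC.
have -> : I - (v P - v Q) = (I - (mpoly_fun q P - mpoly_fun q Q)) -
    (v P - mpoly_fun q P) + (v Q - mpoly_fun q Q) by ring.
apply: le_trans (ler_normD _ _) _; apply: lerD => //.
by apply: le_trans (ler_normB _ _) _; apply: lerD.
Qed.

End WeakConstraint.

(** * Moments of a measure and comparison of the values *)

Section MomentsOfMeasure.
Variables (R : realType) (n m : nat).
Local Notation K := (n.+1 + m.+1)%N.
Variables (G : set 'rV[R]_K) (mu : {measure set (BorelK R n m) -> \bar R}).
Hypotheses (cG : compact G) (muT : (mu setT < +oo)%E).

Definition moments (b : 'X_{1..K}) : R :=
  fine (\int[mu]_(x in G) (mpoly_fun 'X_[b] x)%:E)%E.

Lemma ell_moments h :
  (\int[mu]_(x in G) (mpoly_fun h x)%:E)%E = (ell moments h)%:E.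
Proof.
have mG : measurable (G : set (BorelK R n m)).
  by apply: closed_borel_measurable; apply: compact_closed => //; exact: norm_hausdorff.
have muG : (mu G < +oo)%E.
  by apply: le_lt_trans muT; apply: le_measure; rewrite ?inE.
have intp q : mu.-integrable G (fun x => (mpoly_fun q x)%:E).
  have [B _ hB] := compact_continuous_bounded cG (@mpoly_fun_continuous _ _ q).
  apply: (continuous_borel_integrable (B := B)) => //.
  exact: mpoly_fun_continuous.
rewrite {1}[h]mpolyE /ell; elim: (msupp h) => [|b s IH].
  rewrite !big_nil (eq_integral (cst 0%E)) ?integral0// => x _.
  by rewrite /mpoly_fun meval0.
rewrite !big_cons EFinD -IH EFinM /moments fineK ?integrable_fin_num//.
rewrite -integralZl// -integralD//; last by apply: integrableZl.
by apply: eq_integral => x _; rewrite -EFinM -EFinD /mpoly_fun mevalD mevalZ.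
Qed.

End MomentsOfMeasure.

Lemma transport_polyX (R : realType) n m p (fh : 'I_n -> {mpoly R[n.+1 + m.+1]}) a :
  transport_poly p fh 'X_[a] = Lpoly p fh a.
Proof. by rewrite /transport_poly msuppX big_seq1 mcoeffX eqxx scale1r. Qed.

Theorem theorem4p2 (R : realType) (n m : nat) (t0 tf : R) (y0 yf : 'rV[R]_n)
    (p : nat) (l : {mpoly R[n.+1 + m]}) (f : 'I_n -> {mpoly R[n.+1 + m]})
    (nY : nat) (gY : 'I_nY -> {mpoly R[n]})
    (nG : nat) (g : 'I_nG.+1 -> {mpoly R[n.+1 + m.+1]}) (d0 : nat) :
  0 <= t0 -> t0 < tf -> ~~ odd p ->
  (* l and f have degree at most p in u *)
  (forall mon, mon \in msupp l -> (udeg mon <= p)%N) ->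
  (forall j mon, mon \in msupp (f j) -> (udeg mon <= p)%N) ->
  (* Y is basic semialgebraic and its description contains a ball constraint *)
  (exists j rY, gY j = rY%:MP - \sum_(i < n) 'X_i ^+ 2) ->
  (* G = T x Y x W = {g_i >= 0}, g_0 = 1, one g_i is a ball constraint *)
  Gset t0 tf (semialg gY) p = [set x | forall i, 0 <= evalK (g i) x] ->
  g ord0 = 1 ->
  (exists i r, g i = r%:MP - \sum_(j < n.+1 + m.+1) 'X_j ^+ 2) ->
  (* d0 is the smallest integer bounding all degrees by 2 d0 *)
  deg_bounded d0 (hompoly p l) (fun j => hompoly p (f j)) g ->
  (forall d, deg_bounded d (hompoly p l) (fun j => hompoly p (f j)) g ->
     (d0 <= d)%N) ->
  (forall d, (d0 <= d)%N ->
     (pd d t0 tf y0 yf p (hompoly p l) (fun j => hompoly p (f j)) g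
      <= pd d.+1 t0 tf y0 yf p (hompoly p l) (fun j => hompoly p (f j)) g)%E) /\
  (forall d, (d0 <= d)%N ->
     (pd d t0 tf y0 yf p (hompoly p l) (fun j => hompoly p (f j)) g
      <= pinf t0 tf y0 yf p (hompoly p l) (fun j => hompoly p (f j)) g)%E) /\
  pinf t0 tf y0 yf p (hompoly p l) (fun j => hompoly p (f j)) g
  = pF t0 tf y0 yf (semialg gY) p (hompoly p l) (fun j => hompoly p (f j)).
Proof.
move=> _ _ _ _ _ _ HG g0 [i1 [rb g1]] _ _.
set lh := hompoly p l; set fh := fun j => hompoly p (f j).
split=> [d _|].
  (* The equations of order [d] are among those of order [d.+1], and the localizing matrices of
     order [d] are principal submatrices of those of order [d.+1]. *)
  apply: ereal_inf_le_tmp => _ [z [h1 h2] <-]; exists z => //; split=> [a ha|i].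
    by apply: h1; apply: leq_trans ha _; rewrite ltnS leq_mul2l leqnSn.
  by apply: loc_psd_leq (h2 i); apply: leq_sub2r.
split=> [d _|].
  by apply: ereal_inf_le_tmp => _ [z [h1 h2] <-]; exists z.
have cG : compact (basic_set g) := basic_set_compact g1.
have HG' : Gset t0 tf (semialg gY) p = basic_set g by exact: HG.
apply/eqP; rewrite eq_le; apply/andP; split.
  (* From a measure to a sequence: its moments satisfy the equations because monomials are C1 test
     functions, and the localizing conditions because each [g i] is nonnegative on the set of
     integration. *)
  apply/ereal_infP => _ [mu [muT [_ weak]] <-]; rewrite HG' in weak *.
  have repr := ell_moments cG muT.
  apply: ereal_inf_lbound; exists (moments (basic_set g) mu); last first.
    by rewrite -repr.
  split=> [a|i d].
    apply: EFin_inj; rewrite -repr -transport_polyX.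
    rewrite (_ : bval _ _ _ _ a =
      mpoly_fun 'X_[a] (pt tf yf) - mpoly_fun 'X_[a] (pt t0 y0))//.
    rewrite -(weak _ (mpoly_fun_C1 'X_[a])).
    by apply: eq_integral => x _; rewrite weak_constraint_poly.
  apply/loc_psdP => q _; rewrite -lee_fin -repr; apply: integral_ge0 => x Gx.
  by rewrite lee_fin /mpoly_fun mevalM rmorphXn mulr_ge0 ?sqr_ge0//; exact: Gx.
(* From a sequence to a measure: the conditions of all orders give nonnegativity on [g i] times
   every square, hence a representing measure, with the same cost. *)
apply/ereal_infP => _ [z [h1 h2] <-].
have Lg i q : 0 <= ell z (g i * q ^+ 2).
  by move/loc_psdP: (h2 i (msize q)); apply; exact: leqnSn.
have [mu [muT muGC repr]] := archimedean_moment g0 g1 Lg.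
apply: ereal_inf_lbound; exists mu; rewrite HG'; last exact: repr.
split=> //; split=> //.
(* By density only polynomial test functions remain, and for them the constraint is a linear
   combination of the moment equations. *)
apply: weak_constraint_density => // q; rewrite repr; congr EFin.
rewrite /transport_poly linear_sum /mpoly_fun !mevalE -sumrB.
apply: eq_bigr => a _ /=; rewrite linearZ_LR /= h1 -mulrBr; congr (_ * _).
by rewrite /bval !mevalX.
Qed.
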